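(* Let $(\Omega,\mathscr{F},\mu)$ be a complete probability space, $K\subset L^{0}(\mu)$ absolutely convex, closed in probability and bounded in probability, and $E_K=\mathrm{span}(K)$. Let $\mathrm{sol}(K)=\{f\in L^{0}(\mu):\exists g\in K\text{ with }|f|\leq|g|\}$ and $E_{\mathrm{sol}(K)}=\mathrm{span}(\mathrm{sol}(K))$. Let $\varphi:E_K\to(-\infty,\infty]$ be convex and proper with the equicontinuous Fatou property, and let $\tau$ be a locally convex equicontinuous Köthe topology on $E_K$ with the Krein-Šmulian property which is $F$-regular. Then there exists a convex and proper function $\psi:E_{\mathrm{sol}(K)}\to(-\infty,\infty]$ with the equicontinuous Fatou property (relative to $\mathrm{sol}(K)$, i.e. for sequences contained in $\lambda\,\mathrm{sol}(K)$ for some $\lambda\geq0$) such that $\psi|_{E_K}=\varphi$.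
   Context: $L^{0}(\mu)$ carries the topology of convergence in probability. The polar of $C\subset L^{0}(\mu)$ is $C^{\circ}=\{g\in L^{0}(\mu):\sup_{f\in C}\int_\Omega|fg|\,d\mu\leq1\}$; set $E'_K=\mathrm{span}(K^{\circ})$, paired with $E_K$ via $\langle f,g\rangle=\int_\Omega fg\,d\mu$; for $F\subset E'_K$, $\sigma(E_K,F)$ is the associated weak topology on $E_K$. For a set $L$ (here $K$ or $\mathrm{sol}(K)$), a sequence is $L$-bounded if it lies in $\lambda L$ for some $\lambda>0$, and a convex proper function $\varphi$ on $\mathrm{span}(L)$ has the equicontinuous Fatou property if every $L$-bounded sequence $(f_n)$ converging in probability to $f\in\mathrm{span}(L)$ satisfies $\varphi(f)\leq\liminf_n\varphi(f_n)$. A topology $\tau$ on $E_K$ is an equicontinuous Köthe topology if $K$ is $\tau$-compact and $\tau$ restricted to $K$-bounded sets equals $\sigma(E_K,F)$ for some $F\subset E'_K$ that is solid, separates the points of $E_K$, and contains a strictly positive element; $F$ is then said to induce $\tau$. Such $\tau$ has the Krein-Šmulian property if a convex set $C\subset E_K$ is $\tau$-closed iff $C\cap\lambda K$ is $\tau$-closed for each $\lambda>0$. Under the Krein-Šmulian property, each $g\in F$ gives a $\tau$-continuous functional $f\mapsto\int_\Omega fg\,d\mu$, yielding a natural map $F\to(E_K,\tau)^{\ast}$; $\tau$ is $F$-regular if $F$ induces $\tau$ and this map is surjective. *)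

(* Defs.v *)
(* L^0(mu) is modelled by representatives:
   measurable functions T -> R, everything being considered modulo
   mu-a.e. equality. *)
From HB Require Import structures.
From mathcomp Require Import all_boot all_order all_algebra.
From mathcomp Require Import all_classical all_reals all_analysis.
Set Implicit Arguments. Unset Strict Implicit. Unset Printing Implicit Defensive.
Import Order.TTheory GRing.Theory Num.Theory.
Import numFieldNormedType.Exports.
Local Open Scope classical_set_scope.
Local Open Scope ring_scope.

Section L0.
Context {d : measure_display} {T : measurableType d} {R : realType}
        (mu : probability T R).

Definition L0 : set (T -> R) := [set f | measurable_fun setT f].

Definition aeeq (f g : T -> R) : Prop := {ae mu, forall x, f x = g x}.

(* a set of representatives which is a genuine subset of L^0 *)
Definition saturated (A : set (T -> R)) : Prop :=
  forall f g, A f -> L0 g -> aeeq f g -> A g.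

Definition cvg_in_prob (u : nat -> T -> R) (f : T -> R) : Prop :=
  forall eps : R, 0 < eps ->
    (fun n => mu [set x | eps <= `|u n x - f x|]) @ \oo --> (0 : \bar R).

Definition absolutely_convex (C : set (T -> R)) : Prop :=
  forall f g (a b : R), C f -> C g -> `|a| + `|b| <= 1 ->
    C (fun x => a * f x + b * g x).

Definition convex_set (C : set (T -> R)) : Prop :=
  forall f g (t : R), C f -> C g -> 0 <= t <= 1 ->
    C (fun x => t * f x + (1 - t) * g x).

Definition closed_in_prob (C : set (T -> R)) : Prop :=
  forall (u : nat -> T -> R) f, (forall n, C (u n)) -> L0 f ->
    cvg_in_prob u f -> C f.

Definition bounded_in_prob (C : set (T -> R)) : Prop :=
  forall eps : R, 0 < eps -> exists M : R,
    forall f, C f -> (mu [set x | (M < `|f x|)%R] <= eps%:E)%E.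

Definition spanL0 (C : set (T -> R)) : set (T -> R) :=
  [set f | L0 f /\ exists (n : nat) (c : 'I_n -> R) (g : 'I_n -> T -> R),
     (forall i, C (g i)) /\ aeeq f (fun x => \sum_(i < n) c i * g i x)].

Definition solL0 (C : set (T -> R)) : set (T -> R) :=
  [set f | L0 f /\ exists g, C g /\ {ae mu, forall x, `|f x| <= `|g x|}].

Definition scale_set (l : R) (C : set (T -> R)) : set (T -> R) :=
  [set f | exists g, C g /\ f = (fun x => l * g x)].

Definition pairing (f g : T -> R) : R :=
  fine (\int[mu]_x (f x * g x)%:E).

Definition polar (C : set (T -> R)) : set (T -> R) :=
  [set g | L0 g /\ forall f, C f -> (\int[mu]_x (`|f x * g x|)%:E <= 1)%E].

Definition fun_on_L0 (E : set (T -> R)) (phi : (T -> R) -> \bar R) : Prop :=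
  forall f g, E f -> E g -> aeeq f g -> phi f = phi g.

Definition convex_proper_on (E : set (T -> R)) (phi : (T -> R) -> \bar R)
  : Prop :=
  [/\ (forall f, E f -> (-oo < phi f)%E),
      (exists f, E f /\ (phi f < +oo)%E) &
      (forall f g (t : R), E f -> E g -> 0 <= t <= 1 ->
         (phi (fun x => (t * f x + (1 - t) * g x)%R)
            <= t%:E * phi f + (1 - t)%:E * phi g)%E)].

Definition equicontinuous_Fatou (L : set (T -> R))
  (phi : (T -> R) -> \bar R) : Prop :=
  forall (u : nat -> T -> R) (f : T -> R) (l : R), 0 < l ->
    (forall n, scale_set l L (u n)) -> spanL0 L f -> cvg_in_prob u f ->
    (phi f <= limn_einf (fun n => phi (u n)))%E.

Definition lc_topology (E : set (T -> R)) (tau : set (set (T -> R))) : Prop :=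
  [/\ (forall U, tau U -> U `<=` E /\ saturated U),
      tau E &
  [/\
      (forall G : set (set (T -> R)), G `<=` tau -> tau (\bigcup_(U in G) U)),
      (forall U V, tau U -> tau V -> tau (U `&` V)),
      (forall U f g, tau U -> E f -> E g -> U (fun x => f x + g x) ->
         exists V W, [/\ tau V, tau W, V f, W g &
           forall h k, V h -> W k -> U (fun x => h x + k x)]),
      (forall U (a : R) f, tau U -> E f -> U (fun x => a * f x) ->
         exists (delta : R) V, [/\ 0 < delta, tau V, V f &
           forall (b : R) h, `|b - a| < delta -> V h -> U (fun x => b * h x)]) &
      (forall U f, tau U -> U f ->
         exists V, [/\ tau V, V f, V `<=` U & convex_set V])]].

Definition tau_closed (E : set (T -> R)) (tau : set (set (T -> R)))
  (C : set (T -> R)) : Prop := C `<=` E /\ tau (E `\` C).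

Definition tau_compact (tau : set (set (T -> R))) (C : set (T -> R)) : Prop :=
  forall cov : set (set (T -> R)), cov `<=` tau ->
    C `<=` \bigcup_(U in cov) U ->
    exists (n : nat) (V : 'I_n -> set (T -> R)),
      (forall i, cov (V i)) /\ forall f, C f -> exists i, V i f.

Definition sigma_open (E F : set (T -> R)) (V : set (T -> R)) : Prop :=
  V `<=` E /\
  forall f, V f -> exists (n : nat) (g : 'I_n -> T -> R) (eps : R),
    [/\ 0 < eps, (forall i, F (g i)) &
       forall h, E h ->
         (forall i, `|pairing (fun x => h x - f x) (g i)| < eps) -> V h].

Definition induces (K F : set (T -> R)) (tau : set (set (T -> R))) : Prop :=
  [/\ F `<=` spanL0 (polar K),
      (forall g h, F g -> L0 h -> {ae mu, forall x, `|h x| <= `|g x|} -> F h),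
      (forall f1 f2, spanL0 K f1 -> spanL0 K f2 -> ~ aeeq f1 f2 ->
         exists g, F g /\ pairing f1 g <> pairing f2 g),
      (exists g, F g /\ {ae mu, forall x, 0 < g x}) &
      (forall (l : R) (S : set (T -> R)), 0 < l ->
         (exists U, tau U /\ S = U `&` scale_set l K) <->
         (exists V, sigma_open (spanL0 K) F V /\ S = V `&` scale_set l K))].

Definition equicontinuous_Kothe (K F : set (T -> R))
  (tau : set (set (T -> R))) : Prop :=
  tau_compact tau K /\ induces K F tau.

Definition Krein_Smulian (K : set (T -> R)) (tau : set (set (T -> R)))
  : Prop :=
  forall C : set (T -> R), C `<=` spanL0 K -> saturated C -> convex_set C ->
    (tau_closed (spanL0 K) tau C <->
     forall l : R, 0 < l -> tau_closed (spanL0 K) tau (C `&` scale_set l K)).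

Definition tau_dual (E : set (T -> R)) (tau : set (set (T -> R)))
  (ell : (T -> R) -> R) : Prop :=
  [/\ (forall f g, E f -> E g -> aeeq f g -> ell f = ell g),
      (forall f g (a b : R), E f -> E g ->
         ell (fun x => a * f x + b * g x) = a * ell f + b * ell g) &
      (forall O : set R, open O -> tau [set f | E f /\ O (ell f)])].

Definition F_regular (K F : set (T -> R)) (tau : set (set (T -> R))) : Prop :=
  induces K F tau /\
  forall ell, tau_dual (spanL0 K) tau ell ->
    exists g, F g /\ forall f, spanL0 K f -> ell f = pairing f g.

End L0.

(* Main.v *)
(* The functional [phi] is tau-lower semicontinuous, hence by Hahn-Banach and
   F-regularity a supremum of functions [f |-> <f, g> - a] with [g] in [F]; as
   [F] lies in the span of the polar of [K], which is also the polar of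
   [sol K], the same supremum [psi] makes sense on the span of [sol K].

   Both the lower semicontinuity of [phi] and the Fatou property of [psi] rest
   on the uniform integrability of [{f g : f in K}] for [g] in [F]
   (Dunford-Pettis), which follows from the compactness of [K] by a gliding
   hump.  It passes to [sol K], so that [f |-> <f, g>] is sequentially
   continuous on [sol K] for convergence in probability, and [psi] inherits
   the Fatou property as a supremum.

   By the Krein-Smulian property, lower semicontinuity reduces to closedness of
   [C = {phi <= r}] in [l K] for the weak topology.  If [f0] is in [l K] but
   not in [C], the Fatou property keeps [C] away from [f0] in probability, so
   the integral of a Huber function of [(h - f0) w] ([w > 0] in [F]) is bounded
   below over [h] in [C].  The first-order condition at an approximate
   minimiser, whose gradient is a bounded multiple of [w] and hence in the solid
   set [F], separates [f0] from [C]; this replaces the duality of L^1 and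
   L^oo. *)
Require Import Defs.
From HB Require Import structures.
From mathcomp Require Import all_boot all_order all_algebra.
From mathcomp Require Import all_classical all_reals all_analysis.
From mathcomp Require Import measurable_realfun lra ring.
Import Order.TTheory GRing.Theory Num.Theory.
Import numFieldNormedType.Exports.
Local Open Scope classical_set_scope.
Local Open Scope ring_scope.

(** * The Hahn-Banach theorem through maximal cones of linear constraints *)

Section HahnBanach.
Context {R : realType} {V : lmodType R} (E : set V).
Context (EN : forall y, E y -> E (- y)).

(** A pair [(y, c)] stands for the constraint [l y <= c] on a linear functional [l] to be found. The
    last two conditions say that every [l y] gets an upper bound and that no contradiction
    [0 <= c < 0] follows. A subset [E] of [V] replaces a subspace type, since the intended [V] is
    the space of all functions and [E] a span in it. *)
Definition proper_cone (S : set (V * R)) :=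
  [/\ (forall y c, S (y, c) -> E y),
      (forall y1 c1 y2 c2, S (y1, c1) -> S (y2, c2) -> S (y1 + y2, c1 + c2)),
      (forall a y c, 0 <= a -> S (y, c) -> S (a *: y, a * c)),
      (forall y, E y -> exists c, S (y, c)) &
      (forall c, S (0, c) -> 0 <= c)].

(** The sharpest upper bound on [l y] that the constraints contain. *)
Definition cone_gauge (S : set (V * R)) (y : V) : R :=
  inf [set c | S (y, c)].

(** A bound [c] for [- y] makes [- c] a lower bound for all bounds of [y], because the two
    constraints add up to one at [0]. *)
Lemma cone_gauge_inf S y : proper_cone S -> E y ->
  has_inf [set c | S (y, c)].
Proof.
move=> [SE SD SZ St S0] Ey; split; first exact: St.
have [c Sc] := St _ (EN _ Ey).
exists (- c) => c' /= Sc'.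
rewrite -subr_ge0 opprK; apply: S0.
by have := SD _ _ _ _ Sc' Sc; rewrite subrr.
Qed.

Lemma cone_gauge_le S y c : proper_cone S -> S (y, c) -> cone_gauge S y <= c.
Proof.
move=> oS Sc; apply: ge_inf => //.
by case: (cone_gauge_inf S y oS) => //; case: oS => SE *; exact: SE Sc.
Qed.

Lemma cone_gauge_lt S y e : proper_cone S -> E y -> 0 < e ->
  exists2 c, S (y, c) & c < cone_gauge S y + e.
Proof.
move=> oS Ey e0; have := @inf_adherent _ _ e e0 (cone_gauge_inf S y oS Ey).
by move=> [c Sc ce]; exists c.
Qed.

Lemma cone_gaugeD S y z : proper_cone S -> E y -> E z ->
  cone_gauge S (y + z) <= cone_gauge S y + cone_gauge S z.
Proof.
move=> oS Ey Ez; apply/ler_addgt0Pr => e e0.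
have [|c Sc ce] := cone_gauge_lt S y (e / 2) oS Ey; first by rewrite divr_gt0.
have [|c' Sc' ce'] := cone_gauge_lt S z (e / 2) oS Ez; first by rewrite divr_gt0.
have : S (y + z, c + c') by case: oS => _ SD *; exact: SD.
move/(cone_gauge_le _ _ _ oS) => H; lra.
Qed.

Lemma cone_gaugeZ S a y : proper_cone S -> E y -> 0 <= a ->
  cone_gauge S (a *: y) <= a * cone_gauge S y.
Proof.
move=> oS Ey a0; apply/ler_addgt0Pr => e e0.
(* The denominator [a + 1] also covers [a = 0]. *)
have [|c Sc ce] := cone_gauge_lt S y (e / (a + 1)) oS Ey.
  by rewrite divr_gt0// ltr_wpDl.
have : S (a *: y, a * c) by case: oS => _ _ SZ *; exact: SZ.
move/(cone_gauge_le _ _ _ oS) => H; apply: (le_trans H).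
apply: (@le_trans _ _ (a * (cone_gauge S y + e / (a + 1)))).
  by rewrite ler_wpM2l// ltW.
rewrite mulrDr lerD2l mulrCA ger_pMr// ler_pdivrMr ?mul1r; lra.
Qed.

(** Zorn's lemma is applied to the sets whose union with [S] is proper, rather than to the cones
    above [S], so that the empty chain has an admissible union. *)
Lemma maximal_proper_cone S : proper_cone S ->
  exists M, [/\ proper_cone M, S `<=` M &
    forall M', proper_cone M' -> M `<=` M' -> M' `<=` M].
Proof.
move=> oS.
have [F FP Ftot|A [oA Amax]] := @Zorn_bigcup _ [set A | proper_cone (S `|` A)].
  have [->|/set0P[A0 FA0]] := eqVneq F set0; first by rewrite /= bigcup_set0 setU0.
  have sub A : F A -> S `|` A `<=` S `|` \bigcup_(X in F) X.
    by move=> FA; apply: setUS; exact: bigcup_sup.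
  (* The chain being total, any two elements of the union already lie in one member, and each
     closure condition is checked there. *)
  have dir p q : (S `|` \bigcup_(X in F) X) p -> (S `|` \bigcup_(X in F) X) q ->
      exists2 A, F A & (S `|` A) p /\ (S `|` A) q.
    move=> [Sp|[A FA Ap]] [Sq|[B FB Bq]].
    - by exists A0 => //; split; left.
    - by exists B => //; split; [left|right].
    - by exists A => //; split; [right|left].
    - case: (Ftot _ _ FA FB) => AB.
      + by exists B => //; split; right => //; exact: AB.
      + by exists A => //; split; right => //; exact: AB.
  split.
  - by move=> y c /[dup] /dir H /H [A FA [Ay _]]; case: (FP _ FA) => SE *; exact: SE Ay.
  - move=> y1 c1 y2 c2 /dir H /H [A FA [A1 A2]].
    by apply: (sub _ FA); case: (FP _ FA) => _ SD *; exact: SD.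
  - move=> a y c a0 /[dup] /dir H /H [A FA [Ay _]].
    by apply: (sub _ FA); case: (FP _ FA) => _ _ SZ *; exact: SZ.
  - by move=> y Ey; case: oS => _ _ _ St _; have [c Sc] := St _ Ey; exists c; left.
  - by move=> c /[dup] /dir H /H [A FA [Ay _]]; case: (FP _ FA) => _ _ _ _; exact.
exists (S `|` A); split => // M' oM' SAM'.
have [AM'|nM'A] := pselect (M' `<=` A).
  by apply: (subset_trans AM'); exact: subsetUr.
exfalso; apply: (Amax M'); last first.
  by rewrite /= setUidr//; apply: subset_trans SAM'; exact: subsetUl.
by split => //; apply: subset_trans SAM'; exact: subsetUr.
Qed.

(* On a maximal cone the pair [(y, - q (- y))] can be adjoined, hence already
   belongs to it, so that the gauge [q] is odd and therefore linear. *)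
Lemma maximal_cone_gauge_odd M y : proper_cone M ->
  (forall M', proper_cone M' -> M `<=` M' -> M' `<=` M) ->
  E y -> (forall y1 y2, E y1 -> E y2 -> E (y1 + y2)) ->
  (forall a y, E y -> E (a *: y)) ->
  cone_gauge M (- y) = - cone_gauge M y.
Proof.
move=> oM Mmax Ey ED EZ; have [ME MD MZ Mt M0] := oM.
have E0 : E 0 by rewrite -(subrr y); apply: ED => //; exact: EN.
set c0 := - cone_gauge M (- y).
pose M' := [set p : V * R | exists t z c, [/\ 0 <= t, M (z, c) &
   p = (z + t *: y, c + t * c0)]].
have M00 : M (0, 0).
  have [c Mc] := Mt 0 E0; have := MZ 0 _ _ (lexx _) Mc.
  by rewrite scale0r mul0r.
have oM' : proper_cone M'.
  split.
  - move=> y' c' [t [z [c [t0 Mz [-> _]]]]]; apply: ED; [exact: ME Mz|exact: EZ].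
  - move=> y1 c1 y2 c2 [t [z [c [t0 Mz [-> ->]]]]] [t' [z' [c' [t0' Mz' [-> ->]]]]].
    exists (t + t'), (z + z'), (c + c'); split; [by rewrite addr_ge0|exact: MD|].
    by rewrite scalerDl mulrDl; congr pair; rewrite addrACA.
  - move=> a y1 c1 a0 [t [z [c [t0 Mz [-> ->]]]]].
    exists (a * t), (a *: z), (a * c); split; [by rewrite mulr_ge0|exact: MZ|].
    by rewrite scalerDr scalerA mulrDr mulrA.
  - move=> z Ez; have [c Mc] := Mt _ Ez; exists c; exists 0, z, c.
    by split => //; rewrite scale0r mul0r !addr0.
  (* Consistency of the enlarged cone: a constraint at [0] forces [z = - t y]; for [t > 0], [c / t]
     is then a bound for [- y] in [M], hence at least [- c0]. *)
  - move=> c1 [t [z [c [t0 Mz [/esym/eqP ]]]]]; rewrite addr_eq0 => /eqP zE ->.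
    have [t00|tn0] := eqVneq t 0.
      by move: Mz; rewrite zE t00 scale0r mul0r oppr0 addr0; exact: M0.
    have tp : 0 < t by rewrite lt_def tn0.
    have ti0 : 0 <= t^-1 by rewrite invr_ge0.
    have := MZ t^-1 _ _ ti0 Mz.
    rewrite zE scalerN scalerA mulVf// scale1r => /(cone_gauge_le _ _ _ oM).
    rewrite -subr_ge0 => H.
    have -> : c + t * c0 = t * (t^-1 * c + c0) by rewrite mulrDr mulrA divff// mul1r.
    by rewrite mulr_ge0.
have MM' : M `<=` M'.
  move=> [z c] Mz; exists 0, z, c; split => //.
  by rewrite scale0r mul0r !addr0.
have : M (y, c0).
  apply: (Mmax _ oM' MM'); exists 1, 0, 0; split => //.
  by rewrite scale1r mul1r !add0r.
move/(cone_gauge_le _ _ _ oM); rewrite /c0 => H1.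
have := cone_gaugeD _ _ _ oM Ey (EN _ Ey).
rewrite subrr.
have : 0 <= cone_gauge M 0.
  by apply: lb_le_inf; [exists 0|move=> c /M0].
lra.
Qed.

Lemma hahn_banach_cone S :
  (forall y1 y2, E y1 -> E y2 -> E (y1 + y2)) ->
  (forall a y, E y -> E (a *: y)) -> proper_cone S ->
  exists l : V -> R,
    (forall a b y z, E y -> E z -> l (a *: y + b *: z) = a * l y + b * l z) /\
    (forall y c, S (y, c) -> l y <= c).
Proof.
move=> ED EZ /maximal_proper_cone[M [oM SM Mmax]].
have lN y : E y -> cone_gauge M (- y) = - cone_gauge M y.
  by move=> Ey; exact: maximal_cone_gauge_odd.
exists (cone_gauge M); split; last first.
  by move=> y c /SM; exact: cone_gauge_le.
(* By oddness, subadditivity at [- y] and [- z] is the reverse inequality; homogeneity is obtained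
   in the same way. *)
have lD y z : E y -> E z ->
    cone_gauge M (y + z) = cone_gauge M y + cone_gauge M z.
  move=> Ey Ez; apply/eqP; rewrite eq_le cone_gaugeD//=.
  have := cone_gaugeD M (- y) (- z) oM (EN _ Ey) (EN _ Ez).
  by rewrite -opprD (lN _ (ED _ _ Ey Ez)) (lN _ Ey) (lN _ Ez) -opprD lerN2.
have lZp a y : E y -> 0 <= a -> cone_gauge M (a *: y) = a * cone_gauge M y.
  move=> Ey a0; apply/eqP; rewrite eq_le cone_gaugeZ//=.
  have := cone_gaugeZ M a (- y) oM (EN _ Ey) a0.
  by rewrite scalerN (lN _ Ey) (lN _ (EZ a _ Ey)) mulrN lerN2.
have lZ a y : E y -> cone_gauge M (a *: y) = a * cone_gauge M y.
  move=> Ey; have [a0|a0] := leP 0 a; first exact: lZp.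
  rewrite -[a]opprK scaleNr (lN _ (EZ _ _ Ey)).
  have a0' : 0 <= - a by rewrite oppr_ge0 ltW.
  by rewrite (lZp _ _ Ey a0') !mulNr.
by move=> a b y z Ey Ez; rewrite lD ?lZ//; exact: EZ.
Qed.

End HahnBanach.

(** * Integrability, L^1 seminorms on measurable sets, and the pairing *)

Section NormIntegral.
Context {d : measure_display} {T : measurableType d} {R : realType}
        (mu : probability T R).

Definition intg (h : T -> R) : Prop := mu.-integrable setT (EFin \o h).

(** The L^1 seminorm on [A] as a real number. An infinite integral is sent to [0], hence the
    integrability hypotheses in the estimates below. *)
Definition nint (A : set T) (h : T -> R) : R := \int[mu]_(x in A) `|h x|.

Lemma intg_L0 h : intg h -> L0 h.
Proof. by move=> /integrableP[/measurable_EFinP]. Qed.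

Lemma intg_dominated h k : L0 h -> intg k ->
  {ae mu, forall x, `|h x| <= `|k x|} -> intg h.
Proof.
move=> mh /integrableP[mk fk] hk; apply/integrableP; split.
  exact/measurable_EFinP.
apply: le_lt_trans fk; apply: ae_ge0_le_integral => //.
- by apply: measurableT_comp => //; exact/measurable_EFinP.
- exact: measurableT_comp.
- by apply: filterS hk => x hkx _; rewrite /= lee_fin.
Qed.

Lemma intgD h k : intg h -> intg k -> intg (fun x => h x + k x).
Proof. by move=> ih ik; have := integrableD measurableT ih ik. Qed.

Lemma intgZ a h : intg h -> intg (fun x => a * h x).
Proof. by move=> ih; have := integrableZl measurableT a ih. Qed.

Lemma intg_cst a : intg (fun=> a).
Proof. exact: finite_measure_integrable_cst. Qed.

Lemma intg_norm A h : measurable A -> intg h ->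
  mu.-integrable A (EFin \o (fun x => `|h x|)).
Proof.
move=> mA ih; apply: (@integrableS _ _ _ mu setT) => //.
exact: integrable_norm.
Qed.

Lemma nint_ge0 A h : 0 <= nint A h.
Proof. by apply: Rintegral_ge0. Qed.

Lemma nintE A h : measurable A -> intg h ->
  (\int[mu]_(x in A) (`|h x|)%:E = (nint A h)%:E)%E.
Proof.
move=> mA ih; rewrite /nint /Rintegral fineK//.
exact: integrable_fin_num (intg_norm _ _ mA ih).
Qed.

Lemma nint_le_ae A h k : measurable A -> L0 h -> intg k ->
  {ae mu, forall x, A x -> `|h x| <= `|k x|} -> nint A h <= nint A k.
Proof.
move=> mA mh ik hk.
have le1 : (\int[mu]_(x in A) (`|h x|)%:E <= \int[mu]_(x in A) (`|k x|)%:E)%E.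
  apply: ae_ge0_le_integral => //.
  - apply/measurable_EFinP; apply: (measurable_funS measurableT) => //.
    exact: measurableT_comp.
  - apply/measurable_EFinP; apply: (measurable_funS measurableT) => //.
    by apply: measurableT_comp => //; exact: intg_L0.
move: le1; rewrite (nintE A k)// => le1.
rewrite -lee_fin [X in (X <= _)%E](_ : _ = \int[mu]_(x in A) (`|h x|)%:E)%E//.
rewrite /nint /Rintegral fineK// ge0_fin_numE; last exact: integral_ge0.
exact: le_lt_trans le1 (ltry _).
Qed.

Lemma nint_sub A B h : measurable A -> measurable B -> intg h -> A `<=` B ->
  nint A h <= nint B h.
Proof.
move=> mA mB ih AB; rewrite -lee_fin -!nintE//.
apply: ge0_subset_integral => //; apply/measurable_EFinP.
apply: (measurable_funS measurableT) => //.
by apply: measurableT_comp => //; exact: intg_L0.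
Qed.

Lemma nint_setU A B h : measurable A -> measurable B -> intg h ->
  nint (A `|` B) h <= nint A h + nint B h.
Proof.
move=> mA mB ih.
have mBA : measurable (B `\` A) by exact: measurableD.
have -> : A `|` B = A `|` (B `\` A) by rewrite setDE setUIr setUv setIT.
apply: (@le_trans _ _ (nint A h + nint (B `\` A) h)).
  rewrite /nint Rintegral_setU//.
    exact: intg_norm (measurableU _ _ mA mBA) ih.
  by apply/disj_setPS => x [Ax []].
by rewrite lerD2l; apply: nint_sub => //; exact: subDsetl.
Qed.

Lemma nintD A h k : measurable A -> intg h -> intg k ->
  nint A (fun x => h x + k x) <= nint A h + nint A k.
Proof.
move=> mA ih ik; rewrite /nint -RintegralD//; [|exact: intg_norm..].
apply: le_Rintegral => //.
- by apply: intg_norm => //; exact: intgD.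
- by have := integrableD mA (intg_norm _ _ mA ih) (intg_norm _ _ mA ik).
- by move=> x _; exact: ler_normD.
Qed.

Lemma nintZ A a h : measurable A -> intg h ->
  nint A (fun x => a * h x) = `|a| * nint A h.
Proof.
move=> mA ih; rewrite /nint -RintegralZl//; last exact: intg_norm.
by apply: eq_Rintegral => x _; rewrite normrM.
Qed.

Lemma nint_abs_continuous h e : intg h -> 0 < e ->
  exists2 r, 0 < r &
    forall A, measurable A -> (mu A < r%:E)%E -> nint A h <= e.
Proof.
move=> ih e0; have [r [r0 H]] := integral_normr_continuous ih e0.
by exists r => // A mA Ar; exact/ltW/H.
Qed.

Lemma nint_bounded_by A h c : measurable A -> L0 h -> 0 <= c ->
  (forall x, A x -> `|h x| <= c) -> nint A h <= c.
Proof.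
move=> mA mh c0 hc; apply: (@le_trans _ _ (nint A (fun=> c))).
  apply: nint_le_ae => //; first exact: intg_cst.
  by apply: aeW => x Ax; rewrite (ger0_norm c0); exact: hc.
rewrite /nint Rintegral_cst// ger0_norm// ler_piMr//.
by rewrite -lee_fin fineK ?probability_le1// fin_num_measure.
Qed.

Lemma markov_nint h c : intg h -> 0 < c ->
  (mu [set x | (c < `|h x|)%R] <= (nint setT h / c)%:E)%E.
Proof.
move=> ih c0; have mh := intg_L0 _ ih.
set A := [set x | _].
have mA : measurable A.
  by rewrite -[A]setTI; apply: measurable_fun_ltr => //; exact: measurableT_comp.
have : nint A (fun=> c) <= nint setT h.
  apply: (@le_trans _ _ (nint A h)); last exact: nint_sub.
  apply: nint_le_ae => //; first exact: measurable_cst.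
  apply: aeW => x /= Ax; by rewrite gtr0_norm// ltW.
rewrite /nint Rintegral_cst// gtr0_norm// mulrC -ler_pdivlMr//.
by rewrite -lee_fin fineK// fin_num_measure.
Qed.

Lemma pairing_le f g : intg (fun x => f x * g x) ->
  `|pairing mu f g| <= nint setT (fun x => f x * g x).
Proof. by move=> ifg; exact: le_normr_Rintegral. Qed.

Lemma pairingDl a b f1 f2 g :
  intg (fun x => f1 x * g x) -> intg (fun x => f2 x * g x) ->
  pairing mu (fun x => a * f1 x + b * f2 x) g =
  a * pairing mu f1 g + b * pairing mu f2 g.
Proof.
move=> i1 i2; rewrite /pairing -/(Rintegral mu setT _) -/(Rintegral mu setT _).
rewrite -/(Rintegral mu setT _) -RintegralZl// -RintegralZl//.
rewrite -RintegralD//; [|exact: intgZ..].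
by apply: eq_Rintegral => x _; rewrite mulrDl !mulrA.
Qed.

Lemma pairingB f1 f2 g :
  intg (fun x => f1 x * g x) -> intg (fun x => f2 x * g x) ->
  pairing mu (fun x => f1 x - f2 x) g = pairing mu f1 g - pairing mu f2 g.
Proof.
move=> i1 i2; have := pairingDl 1 (-1) _ _ _ i1 i2; rewrite mul1r mulN1r => <-.
by congr pairing; apply/funext => x; rewrite mul1r mulN1r.
Qed.

Lemma pairing_ae f1 f2 g : L0 f1 -> L0 f2 -> L0 g -> aeeq mu f1 f2 ->
  pairing mu f1 g = pairing mu f2 g.
Proof.
move=> m1 m2 mg f12; congr fine; apply: ae_eq_integral => //.
- by apply/measurable_EFinP; exact: measurable_funM.
- by apply/measurable_EFinP; exact: measurable_funM.
- by apply: filterS f12 => x -> _.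
Qed.

Lemma nint_ae A f1 f2 : measurable A -> intg f1 -> intg f2 -> aeeq mu f1 f2 ->
  nint A f1 = nint A f2.
Proof.
move=> mA i1 i2 f12; apply/eqP; rewrite eq_le; apply/andP; split.
- by apply: nint_le_ae => //; [exact: intg_L0|apply: filterS f12 => x -> _].
- by apply: nint_le_ae => //; [exact: intg_L0|apply: filterS f12 => x -> _].
Qed.

End NormIntegral.

(** * Spans, solid hulls, polars and multiples of an absolutely convex set *)

Section Span.
Context {d : measure_display} {T : measurableType d} {R : realType}
        (mu : probability T R).
Implicit Types (C K : set (T -> R)) (f g h : T -> R).

Lemma aeeq_sym f g : aeeq mu f g -> aeeq mu g f.
Proof. by apply: filterS. Qed.

Lemma L0_lin a b f g : L0 f -> L0 g -> L0 (fun x => a * f x + b * g x).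
Proof.
move=> mf mg; apply: measurable_funD; apply: measurable_funM => //;
exact: measurable_cst.
Qed.

Lemma spanL0_L0 C : spanL0 mu C `<=` L0.
Proof. by move=> f []. Qed.

Lemma spanL0_0 C : spanL0 mu C (fun=> 0).
Proof.
split; first exact: measurable_cst.
exists 0%N, (fun=> 0), (fun _ => fun=> 0); split; first by case.
by apply: aeW => x; rewrite big_ord0.
Qed.

Lemma spanL0_sub C : C `<=` L0 -> C `<=` spanL0 mu C.
Proof.
move=> CL f Cf; split; first exact: CL.
exists 1%N, (fun=> 1), (fun=> f); split => //.
by apply: aeW => x; rewrite big_ord1 mul1r.
Qed.

Lemma spanL0_ae C f g : spanL0 mu C f -> L0 g -> aeeq mu f g -> spanL0 mu C g.
Proof.
move=> [mf [n [c [k [Ck fE]]]]] mg fg; split => //; exists n, c, k; split => //.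
by apply: filterS2 fg fE => x -> .
Qed.

Lemma spanL0_lin C a b f g : spanL0 mu C f -> spanL0 mu C g ->
  spanL0 mu C (fun x => a * f x + b * g x).
Proof.
move=> [mf [n [c [k [Ck fE]]]]] [mg [m [e [l [Cl gE]]]]].
split; first exact: L0_lin.
exists (n + m)%N,
  (fun i => match fintype.split i with inl j => a * c j | inr j => b * e j end),
  (fun i => match fintype.split i with inl j => k j | inr j => l j end).
split; first by move=> i; case: (fintype.split i).
apply: filterS2 fE gE => x -> ->; rewrite big_split_ord/= !mulr_sumr.
congr (_ + _); apply: eq_bigr => i _.
- by rewrite (unsplitK (inl i)) mulrA.
- by rewrite (unsplitK (inr i)) mulrA.
Qed.

(** Induction on the number of terms of a linear combination; the last premise is there because
    membership in a span is modulo null sets. *)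
Lemma spanL0_ind C (P : (T -> R) -> Prop) : C `<=` L0 ->
  P (fun=> 0) ->
  (forall a f g, C f -> L0 g -> P g -> P (fun x => a * f x + g x)) ->
  (forall f g, L0 f -> L0 g -> aeeq mu f g -> P f -> P g) ->
  forall f, spanL0 mu C f -> P f.
Proof.
move=> CL P0 PD Pae f [mf [n [c [k [Ck fE]]]]].
suff [mS PS] : L0 (fun x => \sum_(i < n) c i * k i x) /\
    P (fun x => \sum_(i < n) c i * k i x).
  exact: Pae mS mf (aeeq_sym _ _ fE) PS.
elim: n c k Ck {fE} => [|n IHn] c k Ck.
  have -> : (fun x => \sum_(i < 0) c i * k i x) = fun=> 0.
    by apply/funext => x; rewrite big_ord0.
  by split => //; exact: measurable_cst.
have -> : (fun x => \sum_(i < n.+1) c i * k i x) = (fun x => c ord0 * k ord0 x +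
    (\sum_(i < n) c (lift ord0 i) * k (lift ord0 i) x)).
  by apply/funext => x; rewrite big_ord_recl.
have [mS PS] := IHn (fun i => c (lift ord0 i)) (fun i => k (lift ord0 i))
  (fun i => Ck _).
split; last by apply: PD => //.
apply: measurable_funD => //; apply: measurable_funM; first exact: measurable_cst.
exact: CL.
Qed.

Lemma solL0_L0 C : solL0 mu C `<=` L0.
Proof. by move=> f []. Qed.

Lemma sub_solL0 C : C `<=` L0 -> C `<=` solL0 mu C.
Proof. by move=> CL f Cf; split; [exact: CL|exists f; split => //; exact: aeW]. Qed.

Lemma polar_L0 C : polar mu C `<=` L0.
Proof. by move=> f []. Qed.

Lemma sub_spanL0 C1 C2 : C1 `<=` C2 -> spanL0 mu C1 `<=` spanL0 mu C2.
Proof.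
move=> C12 f [mf [n [c [k [Ck fE]]]]]; split => //; exists n, c, k.
by split => // i; exact: C12.
Qed.

(** For [g] in the polar the bound [1] passes from [k] in [K] to every [f] dominated by [k], which
    is why [K] and its solid hull have the same polar. Each further term of a combination adds the
    absolute value of its coefficient to the bound. *)
Lemma polar_bounded K g : K `<=` L0 -> spanL0 mu (polar mu K) g ->
  exists M : R, forall f, solL0 mu K f ->
    intg mu (fun x => f x * g x) /\ nint mu setT (fun x => f x * g x) <= M.
Proof.
move=> KL; move: g; apply: spanL0_ind => [|||g1 g2 m1 m2 g12].
- exact: polar_L0.
- exists 0 => f sf.
  have -> : (fun x => f x * 0) = fun=> 0 by apply/funext => x; rewrite mulr0.
  split; first exact: intg_cst.
  apply: nint_bounded_by => //; first exact: measurable_cst.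
  by move=> x _; rewrite normr0.
- move=> a g1 g2 [mg1 pg1] mg2 [M HM]; exists (`|a| + M) => f sf.
  have [i2 n2] := HM _ sf.
  have [mf [k [Kk fk]]] := sf.
  have ik : intg mu (fun x => k x * g1 x).
    apply/integrableP; split.
      by apply/measurable_EFinP; apply: measurable_funM => //; exact: KL.
    exact: le_lt_trans (pg1 _ Kk) (ltry _).
  have fg1 : {ae mu, forall x, `|f x * g1 x| <= `|k x * g1 x|}.
    by apply: filterS fk => x; rewrite !normrM => H; rewrite ler_wpM2r.
  have i1 : intg mu (fun x => f x * g1 x).
    by apply: intg_dominated ik fg1; exact: measurable_funM.
  have -> : (fun x => f x * (a * g1 x + g2 x)) =
      (fun x => a * (f x * g1 x) + f x * g2 x).
    by apply/funext => x; rewrite mulrDr mulrCA.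
  have ia1 := intgZ _ a _ i1.
  split; first exact: intgD.
  apply: (le_trans (nintD _ _ _ _ measurableT ia1 i2)); apply: lerD => //.
  rewrite nintZ// ler_piMr//.
  apply: (@le_trans _ _ (nint mu setT (fun x => k x * g1 x))).
    apply: nint_le_ae => //; first exact: measurable_funM.
    by apply: filterS fg1.
  by rewrite -lee_fin -nintE//; exact: pg1.
- move=> [M HM]; exists M => f sf; have [i1 n1] := HM f sf.
  have mf := solL0_L0 _ _ sf.
  have fg : {ae mu, forall x, f x * g2 x = f x * g1 x}.
    by apply: filterS g12 => x ->.
  have i2 : intg mu (fun x => f x * g2 x).
    apply: intg_dominated i1 _; first exact: measurable_funM.
    by apply: filterS fg => x ->.
  by split => //; rewrite (nint_ae _ _ _ _ measurableT i2 i1 fg).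
Qed.

Lemma intg_pairing K f g : K `<=` L0 -> spanL0 mu (solL0 mu K) f ->
  spanL0 mu (polar mu K) g -> intg mu (fun x => f x * g x).
Proof.
move=> KL + sg; have mg := spanL0_L0 _ _ sg.
have [M HM] := polar_bounded _ _ KL sg.
move: f; apply: spanL0_ind => [|||f1 f2 m1 m2 f12].
- exact: solL0_L0.
- have -> : (fun x => 0 * g x) = fun=> 0 by apply/funext => x; rewrite mul0r.
  exact: intg_cst.
- move=> a f1 f2 /HM[i1 _] mf2 i2.
  have -> : (fun x => (a * f1 x + f2 x) * g x) =
      (fun x => a * (f1 x * g x) + f2 x * g x).
    by apply/funext => x; rewrite mulrDl mulrA.
  by apply: intgD => //; exact: intgZ.
- move=> i1; apply: intg_dominated i1 _; first exact: measurable_funM.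
  by apply: filterS f12 => x ->.
Qed.

(** A constant sequence converges in probability to every function that equals it almost
    everywhere. *)
Lemma closed_in_prob_saturated K : K `<=` L0 -> closed_in_prob mu K ->
  saturated mu K.
Proof.
move=> KL Kc f g Kf mg fg; apply: (Kc (fun=> f)) => // e e0.
have -> : (fun=> mu [set x | e <= `|f x - g x|]) = (fun _ : nat => 0%E).
  apply/funext => _; apply/negligibleP.
    rewrite -[X in measurable X]setTI; apply: measurable_fun_ler => //.
    apply: measurableT_comp => //; apply: measurable_funB => //; exact: KL.
  apply: negligibleS fg => x /= H fgx; move: H; apply/negP.
  by rewrite fgx subrr normr0 -ltNge.
exact: cvg_cst.
Qed.

Lemma scale_set_saturated K l : 0 < l -> saturated mu K ->
  saturated mu (scale_set l K).
Proof.
move=> l0 K_saturated _ g [k [Kk ->]] mg kg; exists (fun x => l^-1 * g x); split.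
  apply: (K_saturated k) => //; first by apply: measurable_funM => //; exact: measurable_cst.
  by apply: filterS kg => x <-; rewrite mulKf// gt_eqF.
by apply/funext => x; rewrite mulVKf// gt_eqF.
Qed.

Lemma abs_convex_0 K f : absolutely_convex K -> K f -> K (fun=> 0).
Proof.
move=> Ka Kf; have := Ka f f 0 0 Kf Kf; rewrite !normr0 addr0 ler01 => /(_ isT).
by congr K; apply/funext => x; rewrite !mul0r addr0.
Qed.

Lemma abs_convex_lin K l m f g : absolutely_convex K -> 0 <= l -> 0 <= m ->
  0 < l + m ->
  scale_set l K f -> scale_set m K g -> scale_set (l + m) K (fun x => f x + g x).
Proof.
move=> Ka l0 m0 lm0 [k [Kk ->]] [k' [Kk' ->]].
exists (fun x => l / (l + m) * k x + m / (l + m) * k' x); split.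
  have lm0' := ltW lm0.
  apply: Ka => //; rewrite !ger0_norm ?divr_ge0//.
  by rewrite -mulrDl divff// gt_eqF.
apply/funext => x; field; exact: lt0r_neq0.
Qed.

Lemma scale_set_mono K l m : absolutely_convex K -> 0 <= l <= m -> 0 < m ->
  scale_set l K `<=` scale_set m K.
Proof.
move=> Ka /andP[l0 lm] m0 _ [k [Kk ->]].
exists (fun x => l / m * k x + 0 * k x); split.
  have m0' := ltW m0.
  apply: Ka => //; rewrite normr0 addr0 ger0_norm ?divr_ge0//.
  by rewrite ler_pdivrMr// mul1r.
by apply/funext => x; field; exact: lt0r_neq0.
Qed.

(** The multiples of [K] exhaust its span, so every single point is [K]-bounded. *)
Lemma spanL0_scale_set K f : K !=set0 -> K `<=` L0 -> absolutely_convex K ->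
  saturated mu K -> spanL0 mu K f -> exists2 l, 0 < l & scale_set l K f.
Proof.
move=> [k0 Kk0] KL Ka K_saturated; move: f; have K0 := abs_convex_0 _ _ Ka Kk0.
apply: spanL0_ind => // [|a f g Kf mg [l l0 lg]|f g mf mg fg [l l0 lf]].
- by exists 1 => //; exists (fun=> 0); split => //; apply/funext => x; rewrite mulr0.
- exists (`|a| + l); first by rewrite ltr_wpDl.
  apply: abs_convex_lin => //; [exact: ltW|by rewrite ltr_wpDl|].
  (* The sign of [a] is absorbed by the symmetry of [K]; the scale that remains is the absolute
     value of [a], possibly [0]. *)
  exists (fun x => Num.sg a * f x + 0 * f x); split.
    by apply: Ka => //; rewrite normr0 addr0 normr_sg lern1 leq_b1.
  by apply/funext => x; rewrite mul0r addr0 mulrA [`|a| * _]mulrC -numEsg.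
- by exists l => //; exact: scale_set_saturated lf mg fg.
Qed.

Lemma scale_set_spanL0 C l : C `<=` L0 -> scale_set l C `<=` spanL0 mu C.
Proof.
move=> CL _ [k [Ck ->]]; have sk := spanL0_sub _ CL _ Ck.
have := spanL0_lin _ l 0 _ _ sk sk; congr spanL0.
by apply/funext => x; rewrite mul0r addr0.
Qed.

End Span.

(** * The gliding hump *)

Section UniformIntegrability.
Context {d : measure_display} {T : measurableType d} {R : realType}
        (mu : probability T R).

(** Representatives of the unit ball of L^oo, used as test functionals on L^1 and as multipliers on
    [F]. *)
Definition subunit (s : T -> R) := L0 s /\ forall x, `|s x| <= 1.

Lemma subunit_intg s v : subunit s -> intg mu v ->
  intg mu (fun x => v x * s x).
Proof.
move=> [ms s1] iv; have mv := intg_L0 _ _ iv; apply: intg_dominated iv _.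
  exact: measurable_funM.
by apply: aeW => x; rewrite normrM ler_piMr.
Qed.

(** Overwrite [s] on [A] by the sign of [v] or by its opposite. The two pairings differ by twice the
    mass of [v] on [A], so one of them is at least that mass in absolute value. *)
Lemma hump A v s : measurable A -> intg mu v -> subunit s ->
  exists s', [/\ subunit s', (forall x, ~ A x -> s' x = s x) &
    nint mu A v <= `|pairing mu v s'|].
Proof.
move=> mA iv hs; have [ms s1] := hs; have mv := intg_L0 _ _ iv.
pose sgn x : R := if 0 <= v x then 1 else -1.
have msgn : L0 sgn.
  apply: measurable_fun_ifT; [|exact: measurable_cst|exact: measurable_cst].
  by apply: measurable_fun_ler => //; exact: measurable_cst.
have mIA : L0 (\1_A : T -> R) by exact: measurable_indic.
pose cand a x := \1_A x * (a * sgn x) + (1 - \1_A x) * s x.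
have hc a : `|a| = 1 -> subunit (cand a).
  move=> a1; split.
    apply: measurable_funD; apply: measurable_funM => //.
    - by apply: measurable_funM => //; exact: measurable_cst.
    - by apply: measurable_funB => //; exact: measurable_cst.
  move=> x; rewrite /cand indicE; case: (x \in A).
    rewrite subrr mul0r addr0 mul1r normrM a1 mul1r /sgn.
    by case: ifP => _; rewrite ?normrN normr1.
  by rewrite mul0r add0r subr0 mul1r.
have hoff a x : ~ A x -> cand a x = s x.
  by move=> Ax; rewrite /cand indicE memNset//= mul0r add0r subr0 mul1r.
have i1 : intg mu (fun x => v x * cand 1 x).
  by apply: subunit_intg => //; apply: hc; rewrite normr1.
have i2 : intg mu (fun x => v x * cand (-1) x).
  by apply: subunit_intg => //; apply: hc; rewrite normrN normr1.
have E : pairing mu v (cand 1) - pairing mu v (cand (-1)) = 2 * nint mu A v.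
  rewrite [nint _ _ _](Rintegral_mkcond mu A).
  rewrite /pairing -RintegralB// -RintegralZl//; last first.
    have := proj1 (integrable_mkcond _ mA) (intg_norm _ _ _ mA iv).
    by rewrite restrict_EFin.
  apply: eq_Rintegral => x _; rewrite patchE /cand indicE /sgn.
  case: (x \in A); last by rewrite /= [point](_ : _ = 0)//; ring.
  case: (leP 0 (v x)) => vx; [rewrite ger0_norm//|rewrite ltr0_norm//];
  by rewrite mulr1n; ring.
have [H|H] := leP (nint mu A v) `|pairing mu v (cand 1)|.
  by exists (cand 1); split => //; [apply: hc; rewrite normr1|exact: hoff].
exists (cand (-1)); split => //; [by apply: hc; rewrite normrN normr1|exact: hoff|].
have := ler_norm (pairing mu v (cand 1)).
have := ler_norm (- pairing mu v (cand (-1))); rewrite normrN; lra.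
Qed.

Lemma pairing_subunit_close B v s s' : measurable B -> intg mu v ->
  subunit s -> subunit s' -> (forall x, ~ B x -> s x = s' x) ->
  `|pairing mu v s - pairing mu v s'| <= 2 * nint mu B v.
Proof.
move=> mB iv hs hs' ss'.
have is_ := subunit_intg _ _ hs iv; have is' := subunit_intg _ _ hs' iv.
have mv := intg_L0 _ _ iv.
have isB : intg mu (fun x => v x * (s x - s' x)).
  have := intgD _ _ _ is_ (intgZ _ (-1) _ is'); congr intg.
  by apply/funext => x; ring.
have -> : pairing mu v s - pairing mu v s' =
    pairing mu v (fun x => s x - s' x).
  rewrite /pairing -RintegralB//; apply: eq_Rintegral => x _; ring.
apply: (le_trans (pairing_le _ _ _ isB)).
rewrite -(setvU B) setUC.
apply: (le_trans (nint_setU _ _ _ _ mB (measurableC mB) isB)).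
rewrite -[leRHS]addr0; apply: lerD.
- rewrite -[2]ger0_norm// -nintZ//; apply: nint_le_ae => //.
  + exact: intg_L0 isB.
  + exact: intgZ.
  + apply: aeW => x _; rewrite !normrM mulrC; apply: ler_pM => //.
    rewrite [leRHS]ger0_norm//; apply: (le_trans (ler_normB _ _)).
    by have := proj2 hs x; have := proj2 hs' x; lra.
- apply: nint_bounded_by => //; [exact: measurableC|exact: intg_L0 isB|].
  by move=> x Bx; rewrite ss'// subrr mulr0 normr0.
Qed.

(* Gliding hump: [s] is overwritten successively on the sets [A n]; since [v n]
   carries little mass on the later sets, its pairing with the limit remains of
   the order of its mass on [A n]. *)
Lemma gliding_hump (A : nat -> set T) (v : nat -> T -> R) :
  (forall n, measurable (A n)) -> (forall n, intg mu (v n)) ->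
  exists2 s, subunit s & forall n,
    nint mu (A n) (v n) - 2 * nint mu (\bigcup_(k in [set k | (n < k)%N]) A k) (v n)
    <= `|pairing mu (v n) s|.
Proof.
move=> mA iv.
pose overwrites (p : nat * (T -> R)) s := subunit p.2 ->
  [/\ subunit s, (forall x, ~ A p.1 x -> s x = p.2 x) &
    nint mu (A p.1) (v p.1) <= `|pairing mu (v p.1) s|].
have [next nextP] : {next & forall p, overwrites p (next p)}.
  apply: choice => -[n s]; have [hs|hs] := pselect (subunit s).
    by have [s' Hs'] := hump _ _ _ (mA n) (iv n) hs; exists s'.
  by exists s.
pose S := fix S n := if n is n'.+1 then next (n', S n') else (fun=> 0).
have hS n : subunit (S n).
  elim: n => [|n IHn] /=; last by case: (nextP (n, S n) IHn).
  by split; [exact: measurable_cst|move=> x; rewrite normr0].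
have Soff n x : ~ A n x -> S n.+1 x = S n x.
  by move=> Ax; have [_ + _] := nextP (n, S n) (hS n); exact.
have SA n : nint mu (A n) (v n) <= `|pairing mu (v n) (S n.+1)|.
  by have [_ _ +] := nextP (n, S n) (hS n); exact.
(* At points of infinitely many [A k] the sequence may never settle; the upper limit is measurable
   all the same. Truncating it to [-1, 1] changes nothing where the sequence is eventually
   constant. *)
pose L x := limn_sup (fun n => S n x).
have mL : L0 L.
  apply: measurable_fun_limn_sup => [x _|x _|n]; last by case: (hS n).
  - by exists 1 => _ [n _ <-]; apply: le_trans (proj2 (hS n) x); exact: ler_norm.
  - exists (-1) => _ [n _ <-]; rewrite lerNl; apply: le_trans (proj2 (hS n) x).
    by rewrite -normrN; exact: ler_norm.
pose s x := Num.max (-1) (Num.min 1 (L x)).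
have hs : subunit s.
  split.
    apply: measurable_maxr; first exact: measurable_cst.
    by apply: measurable_minr => //; exact: measurable_cst.
  move=> x; rewrite ler_norml /s le_max lexx/= ge_max ge_min lexx/= andbT.
  exact: le_trans (lerN10 _) ler01.
exists s => // n; set B := \bigcup_(k in _) _.
have mB : measurable B.
  by apply: bigcup_measurable => k _; exact: mA.
have sB x : ~ B x -> S n.+1 x = s x.
  move=> Bx; have SE k : S (k + n.+1)%N x = S n.+1 x.
    elim: k => // k IHk; rewrite addSn Soff// => Ax.
    by apply: Bx; exists (k + n.+1)%N => //=; rewrite leq_addl.
  have LE : L x = S n.+1 x.
    suff : (fun k => S k x) @ \oo --> (S n.+1 x : R^o).
      by move/cvg_limn_inf_sup => -[_].
    rewrite -(cvg_shiftn n.+1).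
    by under eq_fun do rewrite SE; exact: cvg_cst.
  have := proj2 (hS n.+1) x; rewrite ler_norml => /andP[l1 l2].
  by rewrite /s LE min_r// max_r.
have := pairing_subunit_close _ _ _ _ mB (iv n) (hS n.+1) hs sB.
have := SA n; move: (pairing mu (v n) (S n.+1)) (pairing mu (v n) s) => a b.
by have := ler_normD (a - b) b; rewrite subrK; lra.
Qed.

End UniformIntegrability.

(** * From weak compactness to uniform integrability *)

Section DunfordPettis.
Context {d : measure_display} {T : measurableType d} {R : realType}
        (mu : probability T R).

(** The point [f] is a cluster point against one test function at a time. This is weaker than a weak
    cluster point, but the gliding hump produces a single functional. *)
Definition weakly_countably_compact (H : set (T -> R)) :=
  forall u : nat -> T -> R, (forall n, H (u n)) -> exists2 f, H f &
    forall s, subunit s -> forall e N, 0 < e ->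
      exists2 n, (N <= n)%N & `|pairing mu (fun x => u n x - f x) s| < e.

Definition uniformly_integrable (H : set (T -> R)) :=
  forall e, 0 < e -> exists2 r, 0 < r & forall A, measurable A ->
    (mu A < r%:E)%E -> forall f, H f -> nint mu A f <= e.

Lemma geometric_tail (A : nat -> set T) (r : nat -> R) n :
  (forall k, measurable (A k)) -> (forall k, 0 < r k) ->
  (forall k, r k.+1 <= r k / 2) -> (forall k, (mu (A k) < (r k)%:E)%E) ->
  (mu (\bigcup_(k in [set k | (n < k)%N]) A k) <= (2 * r n.+1)%:E)%E.
Proof.
move=> mA r0 rS Ar.
(* The bound has the shape of the geometric series summed by [epsilon_trick0]. *)
have rk k : r (k + n.+1)%N <= 2 * r n.+1 / (2 ^ k.+1)%:R.
  elim: k => [|k IHk]; first by rewrite add0n expn1 mulrAC divff ?mul1r.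
  rewrite addSn; apply: (le_trans (rS _)).
  rewrite expnSr natrM invfM mulrA; apply: ler_wpM2r => //.
have -> : \bigcup_(k in [set k | (n < k)%N]) A k =
    \bigcup_k A (k + n.+1)%N.
  apply/seteqP; split => x [k /= nk Ax]; last first.
    by exists (k + n.+1)%N => //=; rewrite leq_addl.
  by exists (k - n.+1)%N => //; rewrite subnK.
apply: (@le_trans _ _ (\sum_(k <oo) mu (A (k + n.+1)%N))%E).
  apply: measure_sigma_subadditive => //.
  by apply: bigcup_measurable => k _; exact: mA.
have r0' : 0 <= 2 * r n.+1 by rewrite mulr_ge0// ltW.
apply: le_trans (epsilon_trick0 xpredT r0').
apply: lee_nneseries => // k _; apply: (le_trans (ltW (Ar _))).
by rewrite lee_fin.
Qed.

(* If uniform integrability failed, there would be [f n] in [H] with mass [e]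
   on sets [A n] such that [f n] is almost null on the later sets; with [f] a
   weak cluster point, the gliding hump yields one functional that stays away
   from [0] on all the [f n - f]. *)
Lemma weakly_countably_compact_ui (H : set (T -> R)) :
  H `<=` intg mu -> weakly_countably_compact H -> uniformly_integrable H.
Proof.
move=> Hi Hc e e0; apply: contrapT => /forall2NP nui.
have e8 : 0 < e / 8 by rewrite divr_gt0.
pose bad r (p : set T * (T -> R)) := 0 < r ->
  [/\ measurable p.1, (mu p.1 < r%:E)%E, H p.2 & e < nint mu p.1 p.2].
have [pick pickP] : {pick & forall r, bad r (pick r)}.
  apply: choice => r; have [r0|r0] := pselect (0 < r); last by exists (set0, fun=> 0).
  have [//|/existsNP[A]] := nui r.
  move=> /not_implyP[mA] /not_implyP[Ar] /existsNP[f] /not_implyP[Hf] /negP.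
  by rewrite -ltNge => Af; exists (A, f).
pose small f r := intg mu f -> 0 < r /\
  forall A, measurable A -> (mu A < r%:E)%E -> nint mu A f <= e / 8.
have [md mdP] : {md & forall f, small f (md f)}.
  apply: choice => f; have [iF|nF] := pselect (intg mu f); last by exists 0.
  by have [r r0 Hr] := nint_abs_continuous _ _ _ iF e8; exists r.
(* Dividing by [4] makes [r] at least halve at each step, and keeps the total measure of the later
   sets, at most [2 r(n+1)], below the modulus of absolute continuity of [f n]. *)
pose r := fix r n := if n is n'.+1
  then Num.min (r n') (md (pick (r n')).2) / 4 else 1.
pose A n := (pick (r n)).1; pose f n := (pick (r n)).2.
have r0 n : 0 < r n.
  elim: n => [|n IHn] //=; rewrite divr_gt0// lt_min IHn/=.
  have [_ _ /Hi ? _] := pickP _ IHn; exact: (proj1 (mdP _ _)).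
have mA n : measurable (A n) by have [] := pickP _ (r0 n).
have Ar n : (mu (A n) < (r n)%:E)%E by have [] := pickP _ (r0 n).
have Hf n : H (f n) by have [] := pickP _ (r0 n).
have Af n : e < nint mu (A n) (f n) by have [] := pickP _ (r0 n).
have [md0 mdE] : (forall n, 0 < md (f n)) /\ (forall n A, measurable A ->
    (mu A < (md (f n))%:E)%E -> nint mu A (f n) <= e / 8).
  by split => n; have [] := mdP _ (Hi _ (Hf n)).
have rS n : r n.+1 <= r n / 2.
  have /= : Num.min (r n) (md (f n)) <= r n by rewrite ge_min lexx.
  by move: (r0 n); rewrite /f; lra.
have rmd n : 2 * r n.+1 < md (f n).
  have /= : Num.min (r n) (md (f n)) <= md (f n) by rewrite ge_min lexx orbT.
  by move: (md0 n); rewrite /f; lra.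
pose B n := \bigcup_(k in [set k | (n < k)%N]) A k.
have mB n : measurable (B n) by apply: bigcup_measurable => k _; exact: mA.
have Br n : (mu (B n) <= (2 * r n.+1)%:E)%E by exact: geometric_tail.
have fB n : nint mu (B n) (f n) <= e / 8.
  by apply: mdE => //; apply: (le_lt_trans (Br n)); rewrite lte_fin.
have [g Hg gP] := Hc f Hf.
have [rg rg0 rgP] := nint_abs_continuous _ _ _ (Hi _ Hg) e8.
(* Any explicit rate of convergence to [0] would serve; this one follows from the halving. *)
have rN n : r n * n.+1%:R <= 1.
  elim: n => [|n IHn]; first by rewrite mulr1.
  apply: (@le_trans _ _ (r n / 2 * n.+2%:R)); first exact: ler_wpM2r.
  have : 0 <= r n * n%:R by rewrite mulr_ge0// ltW.
  move: IHn (r0 n); rewrite -(natr1 n.+1) -(natr1 n).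
  move: (r n) (n%:R : R) => a b; nra.
have [N HN] : exists N, forall n, (N <= n)%N -> 2 * r n < rg.
  exists (Num.bound (2 / rg)) => n Nn.
  have := archi_boundP (divr_ge0 (ler0n R 2) (ltW rg0)).
  rewrite ltr_pdivrMr// => Nrg.
  have n1 : (0 : R) < n.+1%:R by rewrite ltr0n.
  rewrite -(ltr_pM2r n1) -mulrA.
  apply: (@le_lt_trans _ _ 2); first by rewrite ler_piMr.
  apply: (lt_le_trans Nrg); rewrite mulrC.
  apply: ler_wpM2l; first exact: ltW.
  by rewrite ler_nat leqW.
have gN n : (N <= n)%N -> nint mu (A n) g <= e / 8 /\ nint mu (B n) g <= e / 8.
  move=> Nn; split; apply: rgP => //.
    apply: (lt_trans (Ar n)); rewrite lte_fin.
    by move: (HN _ Nn) (r0 n); lra.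
  by apply: (le_lt_trans (Br n)); rewrite lte_fin HN// leqW.
pose v n x := f n x - g x.
have ig := Hi _ Hg.
have iv n : intg mu (v n).
  have := intgD _ _ _ (Hi _ (Hf n)) (intgZ _ (-1) _ ig); congr intg.
  by apply/funext => x; rewrite mulN1r.
have [s hs sP] := gliding_hump mu A v mA iv.
have [n Nn] := gP s hs (e / 8) N e8.
have [gA gB] := gN _ Nn.
have H1 : nint mu (A n) (f n) <= nint mu (A n) (v n) + nint mu (A n) g.
  apply: le_trans (nintD _ _ _ _ (mA n) (iv n) ig).
  by rewrite /nint; under [leRHS]eq_Rintegral do rewrite /v subrK.
have H2 : nint mu (B n) (v n) <= nint mu (B n) (f n) + nint mu (B n) g.
  have := nintD _ _ _ _ (mB n) (Hi _ (Hf n)) (intgZ _ (-1) _ ig).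
  rewrite nintZ// normrN1 mul1r; congr (_ <= _).
  by apply: eq_Rintegral => x _; rewrite /v mulN1r.
(* The hump contributes more than [e - e/8 - 2 (e/8 + e/8) = 3e/8], while the choice of [n] keeps
   the pairing below [e/8]. *)
move: (sP n) (Af n) (fB n); rewrite -/(B n) -/(v n); lra.
Qed.

End DunfordPettis.

(** * The Huber function and its derivative *)

Section Huber.
Context {R : realType}.
Implicit Types x y a : R.

Definition clamp x : R := Num.max (-1) (Num.min 1 x).

(** It equals [x^2 / 2] on [-1, 1] and the absolute value of [x] minus [1/2] outside: convex, of
    linear growth, with derivative [clamp]. It is therefore integrable along L^1 functions and has
    its gradient in L^oo. *)
Definition huber x : R := clamp x * x - clamp x ^+ 2 / 2.

Variant clamp_spec x : R -> Prop :=
| ClampLow of x <= -1 : clamp_spec x (-1)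
| ClampMid of -1 <= x & x <= 1 : clamp_spec x x
| ClampHigh of 1 <= x : clamp_spec x 1.

Lemma clampP x : clamp_spec x (clamp x).
Proof.
rewrite /clamp; have [x1|x1] := leP 1 x.
  by rewrite max_r; [exact: ClampHigh|lra].
have [x2|x2] := leP (-1) x; first by apply: ClampMid => //; exact: ltW.
by apply: ClampLow; exact: ltW.
Qed.

Lemma clamp_norm x : `|clamp x| <= 1.
Proof. by rewrite ler_norml; case: (clampP x) => *; apply/andP; split; lra. Qed.

Lemma clamp_lip x y : `|clamp x - clamp y| <= `|x - y|.
Proof.
have := ler_norm (x - y); have := ler_norm (y - x); rewrite (distrC y x).
by rewrite ler_norml; case: (clampP x) => *; case: (clampP y) => *;
   apply/andP; split; lra.
Qed.

(** The Fenchel-Young inequality: the conjugate of [huber] is [c^2 / 2] on [-1, 1]. *)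
Lemma huber_ge c y : `|c| <= 1 -> c * y - c ^+ 2 / 2 <= huber y.
Proof.
rewrite ler_norml => /andP[c1 c2]; rewrite /huber.
have := sqr_ge0 (y - c); have := sqr_ge0 (c + 1); have := sqr_ge0 (c - 1).
case: (clampP y) => [yl|_ _|yh].
- have : (c + 1) * (y + 1) <= 0 by apply: mulr_ge0_le0; lra.
  nra.
- nra.
- have : (c - 1) * (y - 1) <= 0 by apply: mulr_le0_ge0; lra.
  nra.
Qed.

(* [huber x] is the maximum of [c * x - c ^+ 2 / 2] over [`|c| <= 1], attained
   at [clamp x]. *)
Lemma huber_subgradient x y : huber x + clamp x * (y - x) <= huber y.
Proof.
by apply: le_trans (huber_ge _ _ (clamp_norm x)); rewrite /huber; lra.
Qed.

Lemma huber0 : huber 0 = 0.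
Proof.
by rewrite /huber; case: (clampP 0) => ?; [lra| |lra]; rewrite mulr0 expr0n mul0r subr0.
Qed.

Lemma huber_ge0 x : 0 <= huber x.
Proof. by rewrite /huber; case: (clampP x) => *; nra. Qed.

Lemma huber_le_norm x : huber x <= `|x|.
Proof.
have := ler_norm x; have := ler_norm (- x); rewrite normrN.
by rewrite /huber; case: (clampP x) => *; nra.
Qed.

Lemma huber_lower a x : 0 < a -> a <= 1 -> a <= `|x| -> a ^+ 2 / 2 <= huber x.
Proof.
move=> a0 a1; rewrite /huber; case: (leP 0 x) => x0.
  by rewrite ger0_norm//; case: (clampP x) => *; nra.
by rewrite ltr0_norm//; case: (clampP x) => *; nra.
Qed.

(** The subgradient inequality at [x + y], read at [x], after replacing [clamp (x + y)] by [clamp x]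
    at the cost of the last term. *)
Lemma huber_upper x y :
  huber (x + y) <= huber x + clamp x * y + `|clamp (x + y) - clamp x| * `|y|.
Proof.
have := huber_subgradient (x + y) x.
have := ler_norm ((clamp (x + y) - clamp x) * y); rewrite normrM.
have -> : x - (x + y) = - y by ring.
nra.
Qed.

End Huber.

(** * Separation from [0] in L^1 by minimising a Huber integral *)

Section WeakSeparation.
Context {d : measure_display} {T : measurableType d} {R : realType}
        (mu : probability T R).

Lemma measurable_clamp (v : T -> R) : L0 v -> L0 (clamp \o v).
Proof.
move=> mv; apply: measurable_maxr; first exact: measurable_cst.
by apply: measurable_minr => //; exact: measurable_cst.
Qed.

Lemma measurable_huber (v : T -> R) : L0 v -> L0 (huber \o v).
Proof.
move=> /[dup] mv /measurable_clamp mc; rewrite /huber.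
apply: measurable_funB; first exact: measurable_funM.
by apply: measurable_funM; [exact: measurable_funX|exact: measurable_cst].
Qed.

Lemma intg_huber v : intg mu v -> intg mu (huber \o v).
Proof.
move=> iv; have mv := intg_L0 _ _ iv; apply: intg_dominated (iv) _.
  exact: measurable_huber.
by apply: aeW => x /=; rewrite ger0_norm ?huber_ge0// huber_le_norm.
Qed.

Lemma subunit_clamp (v : T -> R) : L0 v -> subunit (clamp \o v).
Proof. by move=> mv; split=> [|x]; [exact: measurable_clamp|exact: clamp_norm]. Qed.

Lemma intgB h k : intg mu h -> intg mu k -> intg mu (fun x => h x - k x).
Proof.
move=> ih ik; have := intgD _ _ _ ih (intgZ _ (-1) _ ik); congr intg.
by apply/funext => x; rewrite mulN1r.
Qed.

(** The remainder of [huber_upper] is split according to the size of [k]. Above [M] the two values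
    of [clamp] differ by at most [2]; below, [clamp] is 1-Lipschitz, which gives a second factor [t]
    and the bound [M ^+ 2]. *)
Lemma huber_expansion v k t M : intg mu v -> intg mu k -> 0 <= t -> 0 <= M ->
  \int[mu]_x huber (v x + t * k x) <= \int[mu]_x huber (v x)
    + t * pairing mu k (clamp \o v)
    + t * (2 * nint mu [set x | M < `|k x|] k + t * M ^+ 2).
Proof.
move=> iv ik t0 M0; have mv := intg_L0 _ _ iv; have mk := intg_L0 _ _ ik.
have itk := intgZ _ t _ ik.
have ivk := intgD _ _ _ iv itk.
have mvk := intg_L0 _ _ ivk.
pose e x := `|clamp (v x + t * k x) - clamp (v x)| * `|k x|.
have e_le x : e x <= 2 * `|k x|.
  apply: ler_wpM2r => //; apply: (le_trans (ler_normB _ _)).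
  have := clamp_norm (v x + t * k x); have := clamp_norm (v x); lra.
have e0 x : 0 <= e x by exact: mulr_ge0.
have me : L0 e.
  apply: measurable_funM; last exact: measurableT_comp.
  apply: measurableT_comp => //; apply: measurable_funB.
    exact: (measurable_clamp _ mvk).
  exact: measurable_clamp.
have ie : intg mu e.
  apply: intg_dominated (intgZ _ 2 _ ik) _ => //.
  by apply: aeW => x; rewrite ger0_norm// normrM [`|2|]ger0_norm.
have ic : intg mu (fun x => k x * (clamp \o v) x).
  by apply: subunit_intg => //; exact: subunit_clamp.
have ihv := intg_huber _ iv.
have step1 : \int[mu]_x huber (v x + t * k x) <=
    \int[mu]_x (huber (v x) + t * (k x * clamp (v x)) + t * e x).
  apply: le_Rintegral => //; first exact: (intg_huber _ ivk).
    by apply: intgD; [apply: intgD => //; exact: intgZ|exact: intgZ].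
  move=> x _; apply: (le_trans (huber_upper _ _)).
  by rewrite normrM (ger0_norm t0) /e; lra.
apply: (le_trans step1).
rewrite RintegralD//; [|apply: intgD => //; exact: intgZ|exact: intgZ].
rewrite RintegralD//; [|exact: intgZ].
rewrite !RintegralZl//; apply: lerD => //; apply: ler_wpM2l => //.
set A := [set x | _].
have mA : measurable A.
  by rewrite -[A]setTI; apply: measurable_fun_ltr => //; exact: measurableT_comp.
have -> : \int[mu]_x e x = nint mu setT e.
  by apply: eq_Rintegral => x _; rewrite ger0_norm.
rewrite -(setvU A) setUC.
apply: (le_trans (nint_setU _ _ _ _ mA (measurableC mA) ie)).
apply: lerD.
- rewrite -[2]ger0_norm// -nintZ//; apply: nint_le_ae => //; first exact: intgZ.
  by apply: aeW => x _; rewrite ger0_norm// normrM [`|2|]ger0_norm.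
- apply: nint_bounded_by => //; [exact: measurableC|by rewrite mulr_ge0// sqr_ge0|].
  move=> x /negP; rewrite -leNgt => kM; rewrite ger0_norm// /e.
  have := clamp_lip (v x + t * k x) (v x).
  rewrite addrAC subrr add0r normrM (ger0_norm t0) => H.
  rewrite expr2 mulrA; apply: ler_pM => //; apply: (le_trans H).
  exact: ler_wpM2l.
Qed.

(* First-order condition at an approximate minimiser of [v |-> \int huber v];
   the remainder is uniformly small thanks to uniform integrability. *)
Lemma weak_separation (D : set (T -> R)) (m B : R) :
  D `<=` intg mu -> Defs.convex_set D -> uniformly_integrable mu D ->
  (forall v, D v -> nint mu setT v <= B) ->
  0 < m -> (forall v, D v -> m <= \int[mu]_x huber (v x)) ->
  exists2 s, subunit s & forall v, D v -> m / 2 <= pairing mu v s.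
Proof.
move=> Di Dc Du DB m0 Dm.
have [[v0 Dv0]|D0] := pselect (D !=set0); last first.
  exists (fun=> 0); first by split; [exact: measurable_cst|move=> x; rewrite normr0].
  by move=> v Dv; exfalso; apply: D0; exists v.
have B0 : 0 <= B := le_trans (nint_ge0 _ _ _) (DB _ Dv0).
(* Error budget after division by [t]: the tail gives [2 (m/16)], the quadratic term [m/8] and the
   slack of the approximate minimiser [m/4], in total [m/2]. *)
have [r r0 rP] := Du (m / 32) (divr_gt0 m0 (ltr0n _ 32)).
(* Since [2 B < r M], Markov's inequality gives measure below [r] to the set where [w - v] exceeds
   [M]; also [M >= 1]. *)
pose M := 2 * B / r + 1 + 2 * B / r.
have Br0 : 0 <= 2 * B / r by rewrite divr_ge0 ?mulr_ge0// ltW.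
have M1 : 1 <= M by rewrite /M; lra.
have M0 : 0 < M by lra.
pose t := Num.min 1 (m / (8 * M ^+ 2)).
have t0 : 0 < t by rewrite lt_min ltr01/= divr_gt0// mulr_gt0// exprn_gt0.
have t1 : t <= 1 by rewrite ge_min lexx.
have tM : t * M ^+ 2 <= m / 8.
  apply: (@le_trans _ _ (m / (8 * M ^+ 2) * M ^+ 2)).
    by apply: ler_wpM2r; [exact: sqr_ge0|rewrite ge_min lexx orbT].
  by rewrite le_eqVlt; apply/orP; left; apply/eqP; field; exact: lt0r_neq0.
have rem v w : D v -> D w ->
    nint mu [set x | M < `|w x - v x|] (fun x => w x - v x) <= m / 16.
  move=> Dv Dw; have iv := Di _ Dv; have iw := Di _ Dw.
  have iwv := intgB _ _ iw iv.
  have nwv A : measurable A ->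
      nint mu A (fun x => w x - v x) <= nint mu A w + nint mu A v.
    move=> mA; have := nintD _ _ _ _ mA iw (intgZ _ (-1) _ iv).
    rewrite nintZ// normrN1 mul1r; congr (_ <= _).
    by apply: eq_Rintegral => x _; rewrite mulN1r.
  have H := markov_nint _ _ _ iwv M0.
  set A := [set x | _] in H *.
  have mA : measurable A.
    rewrite -[A]setTI; apply: measurable_fun_ltr => //.
    by apply: measurableT_comp => //; exact: intg_L0 iwv.
  have Ar : (mu A < r%:E)%E.
    apply: (le_lt_trans H); rewrite lte_fin ltr_pdivrMr//.
    apply: (le_lt_trans (nwv _ measurableT)).
    have : 2 * B < r * M.
      rewrite /M !mulrDr mulr1 mulrCA divff ?mulr1 ?gt_eqF//; lra.
    by have := DB _ Dv; have := DB _ Dw; lra.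
  apply: (le_trans (nwv _ mA)).
  by have := rP _ mA Ar _ Dv; have := rP _ mA Ar _ Dw; lra.
pose I v := \int[mu]_x huber (v x).
have hI : has_inf [set I v | v in D].
  split; first by exists (I v0), v0.
  by exists m => _ [v Dv <-]; exact: Dm.
have [|_ [v Dv <-] vmin] := @inf_adherent _ _ (t * (m / 4)) _ hI.
  by rewrite mulr_gt0// divr_gt0.
have iv := Di _ Dv; have mv := intg_L0 _ _ iv.
exists (clamp \o v); first exact: subunit_clamp.
have ic w : D w -> intg mu (fun x => w x * (clamp \o v) x).
  by move=> Dw; apply: subunit_intg; [exact: subunit_clamp|exact: Di].
(* The subgradient inequality from [v x] to [0] reads [huber v <= v clamp v]. *)
have vv : m <= pairing mu v (clamp \o v).
  apply: (le_trans (Dm _ Dv)); apply: le_Rintegral => //.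
  - exact: (intg_huber _ iv).
  - exact: ic.
  - move=> x _; have := huber_subgradient (v x) 0; rewrite huber0 /=; lra.
move=> w Dw; have iw := Di _ Dw.
have Dvw : D (fun x => v x + t * (w x - v x)).
  have := Dc w v t Dw Dv; rewrite (ltW t0) t1 => /(_ isT); congr D.
  by apply/funext => x; ring.
have low : I v - t * (m / 4) <= I (fun x => v x + t * (w x - v x)).
  rewrite lerBlDr; apply: (le_trans (ltW vmin)); rewrite lerD2r.
  by apply: ge_inf; [case: hI|exists (fun x => v x + t * (w x - v x))].
have := huber_expansion v (fun x => w x - v x) t M iv (intgB _ _ iw iv)
  (ltW t0) (ltW M0).
rewrite (pairingB mu w v); [|exact: ic..].
move: low; rewrite /I => low up.
have := le_trans low up; have := rem _ _ Dv Dw.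
move: (nint _ _ _) (pairing mu w _) (pairing mu v _) vv => n p q.
set a := \int[mu]_x _; move=> vv nm; rewrite -addrA lerD2l -mulrDr -mulrN.
rewrite ler_pM2l//; lra.
Qed.

(** * Sets of small measure and convergence in probability *)

Lemma cvge0_lt (u : nat -> \bar R) r : u @ \oo --> 0%E -> 0 < r ->
  exists N, forall n, (N <= n)%N -> (u n < r%:E)%E.
Proof.
move=> u0 r0; have /u0[N _ H] : nbhs (0%E : \bar R) [set y | (y < r%:E)%E].
  exact: (@nbhs_open_ereal_lt _ 0 (fun=> r)).
by exists N => n Nn; exact: H.
Qed.

Lemma cvge0_of_le (u : nat -> \bar R) : (forall n, (0 <= u n)%E) ->
  (forall r, 0 < r -> exists N, forall n, (N <= n)%N -> (u n <= r%:E)%E) ->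
  u @ \oo --> 0%E.
Proof.
move=> u0 ule; apply/fine_cvgP; split.
  have [N NP] := ule 1 ltr01; exists N => // n /= /NP un.
  by rewrite ge0_fin_numE//; exact: le_lt_trans un (ltry _).
apply/cvgrPdist_le => e e0; have [N NP] := ule e e0; exists N => // n /= /NP un.
rewrite sub0r normrN ger0_norm ?fine_ge0// -lee_fin fineK//.
by rewrite ge0_fin_numE//; exact: le_lt_trans un (ltry _).
Qed.

Lemma measure_small (A : nat -> set T) r : (forall n, measurable (A n)) ->
  nonincreasing_seq A -> mu (\bigcap_n A n) = 0%E -> 0 < r ->
  exists n, (mu (A n) < r%:E)%E.
Proof.
move=> mA Ad A0 r0; have mI : measurable (\bigcap_n A n).
  exact: bigcap_measurable.
have fin : (mu (A 0%N) < +oo)%E by rewrite ltey_eq fin_num_measure.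
have cv : mu \o A @ \oo --> 0%E.
  by rewrite -A0; exact: nonincreasing_cvg_mu fin mA mI Ad.
by have [N H] := cvge0_lt _ _ cv r0; exists N; exact: H.
Qed.

Lemma measure_tail (w : T -> R) r : L0 w -> 0 < r ->
  exists2 M, 0 < M & (mu [set x | (M < `|w x|)%R] < r%:E)%E.
Proof.
move=> mw r0; pose A n := [set x | n%:R < `|w x|].
have [|||n nr] := measure_small A r _ _ _ r0.
- move=> n; rewrite -[A n]setTI; apply: measurable_fun_ltr => //.
  exact: measurableT_comp.
- move=> m n mn; apply/subsetPset => x; apply: le_lt_trans.
  by rewrite ler_nat.
- rewrite [X in mu X](_ : _ = set0) ?measure0//.
  apply/seteqP; split => x // /(_ (Num.bound `|w x|) I).
  by rewrite /A /= ltNge ltW// archi_boundP.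
exists n.+1%:R; first by rewrite ltr0n.
apply: le_lt_trans nr; apply: le_measure; rewrite ?inE.
- rewrite -[X in measurable X]setTI; apply: measurable_fun_ltr => //.
  exact: measurableT_comp.
- rewrite -[X in measurable X]setTI; apply: measurable_fun_ltr => //.
  exact: measurableT_comp.
- by move=> x; apply: le_lt_trans; rewrite ler_nat.
Qed.

Lemma measure_near0 (w : T -> R) r : L0 w -> {ae mu, forall x, 0 < w x} ->
  0 < r -> exists2 c, 0 < c & (mu [set x | (w x < c)%R] < r%:E)%E.
Proof.
move=> mw w0 r0; pose A n := [set x | w x < n.+1%:R^-1].
have mA n : measurable (A n).
  by rewrite -[A n]setTI; apply: measurable_fun_ltr.
have [||n nr] := measure_small A r mA _ _ r0.
- move=> m n mn; apply/subsetPset => x /=; rewrite /A /= => /lt_le_trans; apply.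
  by rewrite lef_pV2 ?posrE ?ltr0n// ler_nat ltnS.
- apply/negligibleP; first exact: bigcap_measurable.
  apply: negligibleS w0 => x Ax /= wx.
  have := archi_boundP (ltW (_ : 0 < (w x)^-1)).
  rewrite invr_gt0 => /(_ wx) H.
  have := Ax (Num.bound (w x)^-1) I; rewrite /A /= ltNge => /negP; apply.
  rewrite -[leRHS]invrK lef_pV2 ?posrE ?ltr0n ?invr_gt0//.
  by apply: (le_trans (ltW H)); rewrite ler_nat.
by exists n.+1%:R^-1.
Qed.

Lemma cvg_in_prob_tail (u : nat -> T -> R) f eta r : cvg_in_prob mu u f ->
  0 < eta -> 0 < r -> exists N, forall n, (N <= n)%N ->
    (mu [set x | (eta <= `|u n x - f x|)%R] < r%:E)%E.
Proof. by move=> uf eta0; exact: cvge0_lt (uf _ eta0). Qed.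

(** Vitali's theorem. Where [w] exceeds [M] or [u n - f] is at least [e/(4M)], the measure is small
    and uniform integrability applies; elsewhere the integrand is at most [e/4]. *)
Lemma vitali_pairing (u : nat -> T -> R) f w : (forall n, L0 (u n)) -> L0 f ->
  L0 w -> (forall n, intg mu (fun x => u n x * w x)) ->
  intg mu (fun x => f x * w x) ->
  uniformly_integrable mu [set h | exists n, h = (fun x => u n x * w x)] ->
  cvg_in_prob mu u f ->
  (fun n => pairing mu (u n) w) @ \oo --> pairing mu f w.
Proof.
move=> mu_ mf mw iu if_ ui uf; apply/cvgrPdist_le => e e0.
have e4 : 0 < e / 4 by rewrite divr_gt0.
have [r1 r10 r1P] := ui _ e4.
have [r2 r20 r2P] := nint_abs_continuous _ _ _ if_ e4.
pose r := Num.min r1 r2.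
have r0 : 0 < r by rewrite lt_min r10.
have [M M0 Mr] := measure_tail w (r / 2) mw (divr_gt0 r0 (ltr0n _ 2)).
have eM : 0 < e / 4 / M by rewrite divr_gt0.
have [N NP] := cvg_in_prob_tail _ _ _ (r / 2) uf eM (divr_gt0 r0 (ltr0n _ 2)).
near=> n; have Nn : (N <= n)%N by near: n; exists N.
have iB := intgB _ _ if_ (iu n).
have iB' : intg mu (fun x => (f x - u n x) * w x).
  by move: iB; congr intg; apply/funext => x; rewrite mulrBl.
rewrite -(pairingB mu f (u n) w if_ (iu n)).
apply: (le_trans (pairing_le _ _ _ iB')).
set A := [set x | (M < _)%R] in Mr; pose B := [set x | e / 4 / M <= `|u n x - f x|].
have mA : measurable A.
  rewrite -[A]setTI; apply: measurable_fun_ltr => //; exact: measurableT_comp.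
have mB : measurable B.
  rewrite -[B]setTI; apply: measurable_fun_ler => //; apply: measurableT_comp => //.
  by have mun := mu_ n; exact: measurable_funB.
have mD : measurable (A `|` B) by exact: measurableU.
have Dr : (mu (A `|` B) < r%:E)%E.
  apply: (le_lt_trans (measureU2 mu mA mB)).
  by rewrite [r]splitr EFinD; apply: lteD => //; exact: NP.
rewrite -(setvU (A `|` B)) setUC.
apply: (le_trans (nint_setU _ _ _ _ mD (measurableC mD) iB')).
have H1 : nint mu (A `|` B) (fun x => (f x - u n x) * w x) <= e / 2.
  have := nintD _ _ _ _ mD if_ (intgZ _ (-1) _ (iu n)).
  rewrite nintZ// normrN1 mul1r [X in X <= _](_ : _ =
    nint mu (A `|` B) (fun x => (f x - u n x) * w x)); last first.
    by apply: eq_Rintegral => x _; rewrite mulN1r mulrBl.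
  have : nint mu (A `|` B) (fun x => f x * w x) <= e / 4.
    by apply: r2P => //; apply: (lt_le_trans Dr); rewrite lee_fin ge_min lexx orbT.
  have : nint mu (A `|` B) (fun x => u n x * w x) <= e / 4.
    apply: r1P => //; last by exists n.
    by apply: (lt_le_trans Dr); rewrite lee_fin ge_min lexx.
  lra.
have H2 : nint mu (~` (A `|` B)) (fun x => (f x - u n x) * w x) <= e / 4.
  apply: nint_bounded_by => //; [exact: measurableC|exact: intg_L0 iB'|exact: ltW|].
  move=> x /not_orP[/negP + /negP]; rewrite -leNgt -ltNge => wM uM.
  rewrite normrM distrC -[leRHS](divfK (lt0r_neq0 M0)).
  by apply: ler_pM => //; exact: ltW.
lra.
Unshelve. all: by end_near. Qed.

(** Outside the small set where [w < c], a deviation of at least [eta] gives [(u n - f) w] size at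
    least [eta * c], hence a Huber value at least [a ^+ 2 / 2]. Markov's inequality concerns a
    strict superlevel set and is applied at the lower level [a ^+ 2 / 4]. *)
Lemma huber_small_cvg_in_prob (u : nat -> T -> R) f w : (forall n, L0 (u n)) ->
  L0 f -> L0 w -> {ae mu, forall x, 0 < w x} ->
  (forall n, intg mu (fun x => (u n x - f x) * w x)) ->
  (forall n, \int[mu]_x huber ((u n x - f x) * w x) <= n.+1%:R^-1) ->
  cvg_in_prob mu u f.
Proof.
move=> mu_ mf mw w0 iu Iu eta eta0; apply: cvge0_of_le => // r r0.
have r2 : 0 < r / 2 by rewrite divr_gt0.
have [c c0 cr] := measure_near0 w (r / 2) mw w0 r2.
pose a := Num.min 1 (eta * c).
have a0 : 0 < a by rewrite lt_min ltr01/= mulr_gt0.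
have a1 : a <= 1 by rewrite ge_min lexx.
have b0 : 0 < a ^+ 2 / 4 by rewrite divr_gt0// exprn_gt0.
exists (Num.bound (r / 2 * (a ^+ 2 / 4))^-1) => n Nn.
have iv := intg_huber _ (iu n).
have nI : nint mu setT (huber \o (fun x => (u n x - f x) * w x)) <= n.+1%:R^-1.
  apply: le_trans (Iu n); rewrite /nint le_eqVlt; apply/orP; left; apply/eqP.
  by apply: eq_Rintegral => x _; rewrite ger0_norm// huber_ge0.
have := markov_nint _ _ _ iv b0.
set A := [set x | _]; set B := [set x | _] in cr => Am.
have mA : measurable A.
  rewrite -[A]setTI; apply: measurable_fun_ltr => //.
  by apply: measurableT_comp => //; exact: intg_L0 iv.
have mB : measurable B by rewrite -[B]setTI; apply: measurable_fun_ltr.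
apply: (@le_trans _ _ (mu (A `|` B))).
  apply: le_measure; rewrite ?inE.
  - rewrite -[X in measurable X]setTI; apply: measurable_fun_ler => //.
    have mun := mu_ n; apply: measurableT_comp => //; exact: measurable_funB.
  - exact: measurableU.
  move=> x /= ux; have [wc|cw] := ltP (w x) c; [by right|left].
  rewrite /A /= ger0_norm ?huber_ge0//.
  apply: (@lt_le_trans _ _ (a ^+ 2 / 2)).
    have := exprn_gt0 2 a0; lra.
  apply: huber_lower => //; rewrite ge_min normrM; apply/orP; right.
  apply: ler_pM => //; [exact: ltW|exact: ltW|].
  by apply: (le_trans cw); exact: ler_norm.
apply: (le_trans (measureU2 mu mA mB)).
rewrite [r]splitr EFinD; apply: leeD; last exact: ltW.
apply: (le_trans Am); rewrite lee_fin ler_pdivrMr//; apply: (le_trans nI).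
have k0 : 0 < r / 2 * (a ^+ 2 / 4) by rewrite mulr_gt0.
rewrite -[leRHS]invrK lef_pV2 ?posrE ?ltr0n ?invr_gt0//.
have k0' : 0 <= (r / 2 * (a ^+ 2 / 4))^-1 by rewrite invr_ge0 ltW.
apply: (le_trans (ltW (archi_boundP k0'))).
by rewrite ler_nat; exact: leqW.
Qed.

End WeakSeparation.

(** * Lower limits and cones over convex sets *)

Section LimInf.
Context {R : realType}.

Lemma le_limn_einf (u v : nat -> \bar R) : (forall n, (u n <= v n)%E) ->
  (limn_einf u <= limn_einf v)%E.
Proof.
move=> uv; rewrite !limn_einf_lim; apply: lee_lim; [exact: is_cvg_einfs..|].
apply: nearW => n; apply: le_ereal_inf_tmp => _ [k /= nk <-].
by apply: le_trans (uv k); apply: ereal_inf_lbound; exists k.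
Qed.

Lemma limn_einf_le (u : nat -> \bar R) r : (forall n, (u n <= r%:E)%E) ->
  (limn_einf u <= r%:E)%E.
Proof.
move=> ur; apply: (le_trans (le_limn_einf _ (fun=> r%:E) ur)).
have [-> _] := @cvg_limn_einf_sup _ (fun=> r%:E) r%:E (@cvg_cst _ _ _ _ _) => //.
Qed.

Lemma limn_einf_ge (a : nat -> R) (l : R) (u : nat -> \bar R) :
  a @ \oo --> l -> (forall n, ((a n)%:E <= u n)%E) -> (l%:E <= limn_einf u)%E.
Proof.
move=> al au; apply: le_trans (le_limn_einf _ _ au).
have H : (fun n => (a n)%:E) @ \oo --> l%:E by apply/fine_cvgP; split; [exact: nearW|exact: al].
by have [-> _] := cvg_limn_einf_sup H.
Qed.

End LimInf.

(** The cone over a convex set is closed under addition: normalise the weights by their sum, or take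
    any point if the sum is [0]. The real argument of [Q] is meant for an epigraph coordinate. *)
Lemma convex_cone_sum {R : realType} {T : Type} (Q : (T -> R) -> R -> Prop)
    k1 p1 k2 p2 (t1 t2 : R) :
  (forall k1 p1 k2 p2 t, Q k1 p1 -> Q k2 p2 -> 0 <= t <= 1 ->
    Q (fun x => t * k1 x + (1 - t) * k2 x) (t * p1 + (1 - t) * p2)) ->
  Q k1 p1 -> Q k2 p2 -> 0 <= t1 -> 0 <= t2 ->
  exists k p, [/\ Q k p, forall x, t1 * k1 x + t2 * k2 x = (t1 + t2) * k x &
    t1 * p1 + t2 * p2 = (t1 + t2) * p].
Proof.
move=> Qc Q1 Q2 t10 t20; have [t0|t0] := eqVneq (t1 + t2) 0.
  have [t1E t2E] : t1 = 0 /\ t2 = 0 by split; lra.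
  by exists k1, p1; rewrite t1E t2E; split => // [x|]; rewrite !mul0r ?addr0 ?mul0r.
have tp : 0 < t1 + t2 by rewrite lt_def t0 addr_ge0.
have t2E : 1 - t1 / (t1 + t2) = t2 / (t1 + t2) by field.
exists (fun x => t1 / (t1 + t2) * k1 x + (1 - t1 / (t1 + t2)) * k2 x),
  (t1 / (t1 + t2) * p1 + (1 - t1 / (t1 + t2)) * p2); split.
- apply: Qc => //; rewrite divr_ge0 ?(ltW tp)//=.
  by rewrite ler_pdivrMr// mul1r lerDl.
- by move=> x; rewrite t2E; field.
- by rewrite t2E; field.
Qed.

(** * The setting of the extension and the vector topology [tau] *)

Section Extension.
Context {d : measure_display} {T : measurableType d} {R : realType}
        (mu : probability T R).
Context (K F : set (T -> R)) (tau : set (set (T -> R))) (phi : (T -> R) -> \bar R).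
Context (KL : K `<=` L0) (Ka : absolutely_convex K)
        (Kc : closed_in_prob mu K) (K0 : K !=set0).
Context (phi_ae : fun_on_L0 mu (spanL0 mu K) phi)
        (phi_cvx : convex_proper_on (spanL0 mu K) phi)
        (phi_fatou : equicontinuous_Fatou mu K phi).
Context (lc : lc_topology mu (spanL0 mu K) tau) (Kcpt : tau_compact tau K)
        (ind : induces mu K F tau) (KS : Krein_Smulian mu K tau)
        (Freg : F_regular mu K F tau).
Local Notation E := (spanL0 mu K).

Lemma tau_sub U : tau U -> U `<=` E.
Proof. by case: lc => + _ _ => /[apply] -[]. Qed.

Lemma tau_saturated U : tau U -> saturated mu U.
Proof. by case: lc => + _ _ => /[apply] -[]. Qed.

Lemma tauI U V : tau U -> tau V -> tau (U `&` V).
Proof. by case: lc => _ _ [_ + _ _ _]; exact. Qed.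

Lemma tau_local P : (forall h, P h -> exists2 V, tau V & V h /\ V `<=` P) -> tau P.
Proof.
move=> HP; have [_ _ [HU _ _ _ _]] := lc.
rewrite (_ : P = \bigcup_(V in [set V | tau V /\ V `<=` P]) V).
  by apply: HU => V [].
apply/seteqP; split => [h /HP[V tV [Vh VP]]|h [V [_ VP] Vh]]; last exact: VP.
by exists V.
Qed.

Lemma tauU U V : tau U -> tau V -> tau (U `|` V).
Proof.
move=> tU tV; apply: tau_local => h [Uh|Vh].
- by exists U => //; split => //; exact: subsetUl.
- by exists V => //; split => //; exact: subsetUr.
Qed.

Lemma tau_finI n (V : 'I_n -> set (T -> R)) : (forall i, tau (V i)) ->
  tau [set f | E f /\ forall i, V i f].
Proof.
elim: n V => [|n IHn] V tV.
  rewrite (_ : [set f | _] = E); first by case: lc.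
  by apply/seteqP; split => f; [case|split => // -[]].
rewrite (_ : [set f | _] = V ord0 `&` [set f | E f /\ forall i, V (lift ord0 i) f]).
  by apply: tauI => //; exact: IHn.
apply/seteqP; split => f [].
  by move=> Ef Vf; split => //; split => // i; exact: Vf.
move=> V0 [Ef Vf]; split => // i; have [<-//|/unlift_some[j -> _]] := eqVneq ord0 i.
exact: Vf.
Qed.

Lemma tau_affine U a g : tau U -> E g ->
  tau [set h | E h /\ U (fun x => a * h x + g x)].
Proof.
move=> tU Eg; have [_ _ [_ _ HD HZ _]] := lc.
apply: tau_local => h [Eh Uh].
have Eah : E (fun x => a * h x).
  have := spanL0_lin mu _ a 0 _ _ Eh Eh; congr spanL0.
  by apply/funext => x; rewrite mul0r addr0.
have [V [W [tV tW Vh Wg VW]]] := HD U _ g tU Eah Eg Uh.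
have [r [V' [r0 tV' Vh' HV']]] := HZ V a h tV Eh Vh.
exists V' => //; split => // k V'k; split; first exact: tau_sub V'k.
by apply: VW => //; apply: HV' => //; rewrite subrr normr0.
Qed.

Lemma tau_convex U f : tau U -> U f ->
  exists V, [/\ tau V, V f, V `<=` U & Defs.convex_set V].
Proof. by move=> tU Uf; case: lc => _ _ [_ _ _ _ H]; exact: H. Qed.

(** Continuity of scalar multiplication at the scalar [0]. *)
Lemma tau_absorbing U y : tau U -> E y -> U (fun=> 0) ->
  exists2 s, 0 < s & U (fun x => s * y x).
Proof.
move=> tU Ey U0; have [_ _ [_ _ _ HZ _]] := lc.
have U0' : U (fun x => 0 * y x).
  by move: U0; congr U; apply/funext => x; rewrite mul0r.
have [r [V [r0 tV Vy HV]]] := HZ U 0 y tU Ey U0'.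
exists (r / 2); first by rewrite divr_gt0.
by apply: HV => //; rewrite subr0 gtr0_norm ?divr_gt0// ltr_pdivrMr// ltr_pMr// ltr1n.
Qed.

(** * The pairing with [F] and the weak topology on multiples of [K] *)

Lemma K_saturated : saturated mu K.
Proof. exact: closed_in_prob_saturated. Qed.

Lemma F_polar g : F g -> spanL0 mu (polar mu K) g.
Proof. by case: ind => + _ _ _ _; exact. Qed.

Lemma F_L0 g : F g -> L0 g.
Proof. by move=> /F_polar; exact: spanL0_L0. Qed.

(** Testing [f w] against [s] thus amounts to testing [f] against an element of [F]. *)
Lemma F_subunit s g : subunit s -> F g -> F (fun x => s x * g x).
Proof.
move=> [ms s1] Fg; case: ind => _ Fsol _ _ _; apply: (Fsol _ _ Fg).
  by apply: measurable_funM => //; exact: F_L0.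
by apply: aeW => x; rewrite normrM ler_piMl.
Qed.

Lemma E_sol : E `<=` spanL0 mu (solL0 mu K).
Proof. by apply: sub_spanL0; exact: sub_solL0. Qed.

Lemma intg_solF f g : spanL0 mu (solL0 mu K) f -> F g ->
  intg mu (fun x => f x * g x).
Proof. by move=> sf /F_polar; exact: intg_pairing. Qed.

Lemma intg_EF f g : E f -> F g -> intg mu (fun x => f x * g x).
Proof. by move=> /E_sol; exact: intg_solF. Qed.

Lemma pairingEB f h g : E f -> E h -> F g ->
  pairing mu (fun x => f x - h x) g = pairing mu f g - pairing mu h g.
Proof. by move=> Ef Eh Fg; apply: pairingB; exact: intg_EF. Qed.

Lemma scale_set1 : scale_set 1 K = K.
Proof.
apply/seteqP; split => f.
  by move=> [k [Kk ->]]; move: Kk; congr K; apply/funext => x; rewrite mul1r.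
by move=> Kf; exists f; split => //; apply/funext => x; rewrite mul1r.
Qed.

Lemma scaleK_E l : scale_set l K `<=` E.
Proof. exact: scale_set_spanL0. Qed.

Lemma K_E : K `<=` E.
Proof. exact: spanL0_sub. Qed.

Lemma rel_open V l : 0 < l -> sigma_open mu E F V ->
  exists U, tau U /\ U `&` scale_set l K = V `&` scale_set l K.
Proof.
move=> l0 oV; case: ind => _ _ _ _ H.
by have [|U [tU ->]] := proj2 (H l (V `&` scale_set l K) l0); exists V + exists U.
Qed.

Lemma sigma_open_ball f g e : E f -> F g -> 0 < e ->
  sigma_open mu E F [set h | E h /\ `|pairing mu h g - pairing mu f g| < e].
Proof.
move=> Ef Fg e0; split => [h []//|h [Eh he]].
exists 1%N, (fun=> g), (e - `|pairing mu h g - pairing mu f g|); split => //.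
  by rewrite subr_gt0.
move=> k Ek /(_ ord0); rewrite pairingEB// => H; split => //.
have := ler_normD (pairing mu k g - pairing mu h g)
  (pairing mu h g - pairing mu f g).
by rewrite addrA subrK; lra.
Qed.

(** * Uniform integrability over [K] and its solid hull *)

(** If no cluster point existed, every [h] in [K] would have a neighbourhood that the sequence
    eventually avoids. Finitely many of them cover [K], and a late term of the sequence would lie in
    none. *)
Lemma K_weakly_countably_compact w : F w ->
  weakly_countably_compact mu [set h | exists2 f, K f & h = (fun x => f x * w x)].
Proof.
move=> Fw u uH.
have [f fP] : {f : nat -> T -> R & forall n, K (f n) /\ u n = (fun x => f n x * w x)}.
  apply: (choice (P := fun n f => K f /\ u n = (fun x => f x * w x))) => n.
  by have [f Kf ->] := uH n; exists f.
have uE n h s : K h -> subunit s ->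
    pairing mu (fun x => u n x - h x * w x) s =
    pairing mu (f n) (fun x => s x * w x) - pairing mu h (fun x => s x * w x).
  move=> Kh hs; have [Kf ->] := fP n.
  rewrite -pairingEB//; [|exact: K_E..|exact: F_subunit].
  by rewrite /pairing; congr fine; apply: eq_integral => x _; congr EFin; ring.
apply: contrapT => nH.
pose cov := [set U | tau U /\ exists N, forall n, (N <= n)%N -> ~ U (f n)].
have [||n [V [covV VK]]] := Kcpt cov.
- by move=> U [].
- move=> h Kh; apply: contrapT => hcov; apply: nH.
  exists (fun x => h x * w x); first by exists h.
  move=> s hs e N e0; apply: contrapT => nn; apply: hcov.
  have oV := sigma_open_ball h _ e (K_E _ Kh) (F_subunit s w hs Fw) e0.
  have [U [tU UV]] := rel_open _ 1 ltr01 oV; rewrite scale_set1 in UV.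
  exists U; last first.
    suff [] : (U `&` K) h by [].
    rewrite UV; split => //; split; first exact: K_E.
    by rewrite subrr normr0.
  split => //; exists N => k Nk Uk; apply: nn; exists k => //.
  have [Kf _] := fP k; have : (U `&` K) (f k) by [].
  by rewrite UV => -[[_ +] _]; rewrite uE.
have [N NP] : {N : 'I_n -> nat & forall i k, (N i <= k)%N -> ~ V i (f k)}.
  apply: (choice (P := fun i N => forall k, (N <= k)%N -> ~ V i (f k))) => i.
  by have [_] := covV i.
pose M := (\max_(i < n) N i)%N.
have [Kf _] := fP M; have [i Vi] := VK _ Kf.
exact: NP i M (leq_bigmax i) Vi.
Qed.

Lemma K_ui w : F w ->
  uniformly_integrable mu [set h | exists2 f, K f & h = (fun x => f x * w x)].
Proof.
move=> Fw; apply: weakly_countably_compact_ui; last exact: K_weakly_countably_compact.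
by move=> _ [f Kf ->]; apply: intg_EF => //; exact: K_E.
Qed.

Lemma solK_ui w l : F w -> 0 < l -> uniformly_integrable mu
  [set h | exists2 f, scale_set l (solL0 mu K) f & h = (fun x => f x * w x)].
Proof.
move=> Fw l0 e e0; have [r r0 rP] := K_ui _ Fw (e / l) (divr_gt0 e0 l0).
exists r => // A mA Ar _ [_ [f [sf ->]] ->]; have [mf [k [Kk fk]]] := sf.
have mw := F_L0 _ Fw; have ik := intg_EF _ _ (K_E _ Kk) Fw.
apply: (@le_trans _ _ (nint mu A (fun x => l * (k x * w x)))).
  apply: nint_le_ae => //.
  - by apply: measurable_funM => //; exact: measurable_funM.
  - exact: intgZ.
  - apply: filterS fk => x fk _; rewrite -mulrA !normrM.
    by rewrite ler_wpM2l// ler_wpM2r.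
rewrite nintZ// gtr0_norm// -ler_pdivlMl// mulrC; apply: rP => //.
by exists k.
Qed.

Lemma pairing_cvg (u : nat -> T -> R) f w l : F w -> 0 < l ->
  (forall n, scale_set l (solL0 mu K) (u n)) -> spanL0 mu (solL0 mu K) f ->
  cvg_in_prob mu u f -> (fun n => pairing mu (u n) w) @ \oo --> pairing mu f w.
Proof.
move=> Fw l0 su sf uf.
have Eu n : spanL0 mu (solL0 mu K) (u n).
  by apply: scale_set_spanL0 (su n); exact: solL0_L0.
apply: vitali_pairing => //.
- by move=> n; exact: spanL0_L0 (Eu n).
- exact: spanL0_L0 sf.
- exact: F_L0.
- by move=> n; exact: intg_solF.
- exact: intg_solF.
- move=> e e0; have [r r0 rP] := solK_ui _ _ Fw l0 e e0; exists r => // A mA Ar.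
  by move=> _ [n ->]; apply: rP => //; exists (u n).
Qed.

(** * Closedness of the multiples of [K] *)

(** The usual proof that compact sets are closed in a Hausdorff space. As [tau] is compared with the
    weak topology only on multiples of [K], it runs inside [(m0 + 1) K], which contains both [K] and
    [f0], and [F] separates the points. *)
Lemma tau_K_closed : tau (E `\` K).
Proof.
apply: tau_local => f0 [Ef0 nKf0].
have [m0 m00 m0f0] := spanL0_scale_set mu K _ K0 KL Ka K_saturated Ef0.
have m1 : 0 < m0 + 1 by rewrite addr_gt0.
have mf0 : scale_set (m0 + 1) K f0.
  by apply: scale_set_mono m0f0 => //; rewrite ltW//= lerDl.
have mK k : K k -> scale_set (m0 + 1) K k.
  rewrite -{1}scale_set1; apply: scale_set_mono => //.
  by rewrite ler01 lerDr ltW.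
pose cov := [set U | tau U /\ exists V, [/\ tau V, V f0 &
  forall k, scale_set (m0 + 1) K k -> U k -> ~ V k]].
have [||n [U [covU UK]]] := Kcpt cov.
- by move=> U [].
- move=> f Kf; have Ef := K_E _ Kf.
  have nff0 : ~ aeeq mu f f0.
    by move=> ff0; apply: nKf0; apply: K_saturated Kf (spanL0_L0 _ _ _ Ef0) ff0.
  case: ind => _ _ /(_ _ _ Ef Ef0 nff0)[g [Fg fg]] _ _.
  pose e := `|pairing mu f g - pairing mu f0 g| / 2.
  have e0 : 0 < e by rewrite divr_gt0// normr_gt0 subr_eq0; exact/eqP.
  have [U [tU UE]] := rel_open _ _ m1 (sigma_open_ball f g e Ef Fg e0).
  have [V [tV VE]] := rel_open _ _ m1 (sigma_open_ball f0 g e Ef0 Fg e0).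
  exists U; last first.
    suff [] : (U `&` scale_set (m0 + 1) K) f by [].
    by rewrite UE; split; [split => //; rewrite subrr normr0|exact: mK].
  split => //; exists V; split => //.
    suff [] : (V `&` scale_set (m0 + 1) K) f0 by [].
    by rewrite VE; split => //; split => //; rewrite subrr normr0.
  move=> k mk Uk Vk.
  have [[_ H1] _] : ([set h | E h /\ `|pairing mu h g - pairing mu f g| < e]
    `&` scale_set (m0 + 1) K) k by rewrite -UE.
  have [[_ H2] _] : ([set h | E h /\ `|pairing mu h g - pairing mu f0 g| < e]
    `&` scale_set (m0 + 1) K) k by rewrite -VE.
  have := ler_normD (pairing mu f g - pairing mu k g) (pairing mu k g - pairing mu f0 g).
  rewrite addrA subrK (distrC (pairing mu f g) (pairing mu k g)).
  by rewrite /e in H1 H2; lra.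
have [V VP] : {V : 'I_n -> set (T -> R) & forall i, [/\ tau (V i), V i f0 &
    forall k, scale_set (m0 + 1) K k -> U i k -> ~ V i k]}.
  apply: (choice (P := fun i V => [/\ tau V, V f0 &
    forall k, scale_set (m0 + 1) K k -> U i k -> ~ V k])) => i.
  by have [_] := covU i.
exists [set f | E f /\ forall i, V i f].
  by apply: tau_finI => i; have [] := VP i.
split; first by split => // i; have [] := VP i.
move=> f [Ef Vf]; split => // Kf; have [i Ui] := UK _ Kf.
by have [_ _ /(_ f (mK _ Kf) Ui)] := VP i; exact.
Qed.

Lemma tau_scaleK_closed l : 0 < l -> tau (E `\` scale_set l K).
Proof.
move=> l0; have := tau_affine _ l^-1 _ tau_K_closed (spanL0_0 mu K).
congr tau; apply/seteqP; split => f.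
  move=> [Ef [_ nK]]; split => // -[k [Kk fE]]; apply: nK.
  by move: Kk; congr K; apply/funext => x; rewrite fE addr0 mulKf// gt_eqF.
move=> [Ef nK]; split => //; split.
  have := spanL0_lin mu _ l^-1 0 _ _ Ef Ef; congr spanL0.
  by apply/funext => x; rewrite mul0r.
by move=> Kf; apply: nK; exists (fun x => l^-1 * f x + 0); split => //;
    apply/funext => x; rewrite addr0 mulVKf// gt_eqF.
Qed.

(** * Lower semicontinuity of [phi] *)

Definition sublevel (r : R) : set (T -> R) := [set f | E f /\ (phi f <= r%:E)%E].

Lemma E_lin a b f g : E f -> E g -> E (fun x => a * f x + b * g x).
Proof. exact: spanL0_lin. Qed.

Lemma convex_sublevel r : Defs.convex_set (sublevel r).
Proof.
move=> f g t [Ef fr] [Eg gr] t01; split; first exact: E_lin.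
have [_ _ H] := phi_cvx; apply: (le_trans (H _ _ _ Ef Eg t01)).
have /andP[t0 t1] := t01.
have -> : r%:E = (t%:E * r%:E + (1 - t)%:E * r%:E)%E.
  by rewrite -!EFinM -EFinD; congr EFin; ring.
by apply: leeD; apply: lee_wpmul2l => //; rewrite lee_fin// subr_ge0.
Qed.

Lemma convex_scaleK l : 0 < l -> Defs.convex_set (scale_set l K).
Proof.
move=> l0 _ _ t [f [Kf ->]] [g [Kg ->]] /andP[t0 t1].
exists (fun x => t * f x + (1 - t) * g x); split; last first.
  by apply/funext => x; ring.
by apply: Ka => //; rewrite !ger0_norm ?subr_ge0// addrC subrK.
Qed.

Lemma sublevel_weakly_separated r l f0 : 0 < l -> scale_set l K f0 ->
  ~ sublevel r f0 ->
  exists g, F g /\ exists2 eta, 0 < eta & forall h, sublevel r h ->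
    scale_set l K h -> eta <= pairing mu (fun x => h x - f0 x) g.
Proof.
move=> l0 lf0 nf0; have KE := scaleK_E l.
have Ef0 := KE _ lf0.
have Ksol : scale_set l K `<=` scale_set l (solL0 mu K).
  by move=> _ [k [Kk ->]]; exists k; split => //; exact: sub_solL0.
have [_ _ _ [w [Fw w0]] _] := ind; have mw := F_L0 _ Fw.
pose C := sublevel r `&` scale_set l K.
pose D := [set v | exists2 h, C h & v = (fun x => (h x - f0 x) * w x)].
have iw f : E f -> intg mu (fun x => f x * w x).
  by move=> Ef; exact: intg_EF.
have iB f : E f -> intg mu (fun x => (f x - f0 x) * w x).
  move=> Ef; have := intgB mu _ _ (iw _ Ef) (iw _ Ef0); congr intg.
  by apply/funext => x; rewrite mulrBl.
have Bw f A : E f -> measurable A -> nint mu A (fun x => (f x - f0 x) * w x) <=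
    nint mu A (fun x => f x * w x) + nint mu A (fun x => f0 x * w x).
  move=> Ef mA; have := nintD _ _ _ _ mA (iw _ Ef) (intgZ _ (-1) _ (iw _ Ef0)).
  rewrite (nintZ mu A (-1) _ mA (iw _ Ef0)) normrN1 mul1r; congr (_ <= _).
  by apply: eq_Rintegral => x _; rewrite mulN1r mulrBl.
have Di : D `<=` intg mu by move=> _ [h [_ /KE Eh] ->]; exact: iB.
have Dc : Defs.convex_set D.
  move=> _ _ t [h [hr hl] ->] [k [kr kl] ->] t01.
  exists (fun x => t * h x + (1 - t) * k x); last by apply/funext => x; ring.
  by split; [exact: convex_sublevel|exact: convex_scaleK].
have Dui : uniformly_integrable mu D.
  move=> e e0; have [|s s0 sP] := solK_ui w l Fw l0 (e / 2).
    by rewrite divr_gt0.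
  exists s => // A mA As _ [h [_ hl] ->].
  apply: (le_trans (Bw _ _ (KE _ hl) mA)).
  have := sP _ mA As _ (ex_intro2 _ _ h (Ksol _ hl) erefl).
  have := sP _ mA As _ (ex_intro2 _ _ f0 (Ksol _ lf0) erefl).
  lra.
have [B BP] : exists B, forall v, D v -> nint mu setT v <= B.
  have [M MP] := polar_bounded mu _ _ KL (F_polar _ Fw).
  have lM f : scale_set l K f -> nint mu setT (fun x => f x * w x) <= l * M.
    move=> [k [Kk ->]]; have [ik nk] := MP _ (sub_solL0 mu _ KL _ Kk).
    have -> : (fun x => l * k x * w x) = (fun x => l * (k x * w x)).
      by apply/funext => x; rewrite mulrA.
    by rewrite nintZ// gtr0_norm// ler_wpM2l// ltW.
  exists (l * M + l * M) => _ [h [_ hl] ->].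
  by apply: (le_trans (Bw _ _ (KE _ hl) measurableT)); apply: lerD; exact: lM.
(* Otherwise a sequence in [C] with Huber integrals at most [1/(n+1)] converges to [f0] in
   probability, and the Fatou property puts [f0] in the sublevel set. *)
have [m m0 Dm] : exists2 m, 0 < m & forall v, D v -> m <= \int[mu]_x huber (v x).
  apply: contrapT => nm.
  have [u uP] : {u : nat -> T -> R & forall n, C (u n) /\
      \int[mu]_x huber ((u n x - f0 x) * w x) <= n.+1%:R^-1}.
    apply: (choice (P := fun n f => C f /\
      \int[mu]_x huber ((f x - f0 x) * w x) <= n.+1%:R^-1)) => n.
    apply: contrapT => nu; apply: nm; exists n.+1%:R^-1; first by rewrite invr_gt0.
    move=> _ [h Ch ->]; rewrite leNgt; apply/negP => hn; apply: nu; exists h.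
    by split => //; exact: ltW.
  have ul n : scale_set l K (u n) by have [[]] := uP n.
  have uf0 : cvg_in_prob mu u f0.
    apply: (huber_small_cvg_in_prob mu _ _ w) => //.
    - by move=> n; exact: spanL0_L0 (KE _ (ul n)).
    - exact: spanL0_L0 Ef0.
    - by move=> n; apply: iB; exact: KE.
    - by move=> n; have [] := uP n.
  apply: nf0; split => //; apply: (le_trans (phi_fatou _ _ _ l0 ul Ef0 uf0)).
  by apply: limn_einf_le => n; have [[[]]] := uP n.
have [s hs sP] := weak_separation mu D m B Di Dc Dui BP m0 Dm.
exists (fun x => s x * w x); split; first exact: F_subunit.
exists (m / 2); first by rewrite divr_gt0.
move=> h hr hl; apply: (le_trans (sP _ (ex_intro2 _ _ h (conj hr hl) erefl))).
rewrite le_eqVlt; apply/orP; left; apply/eqP; rewrite /pairing; congr fine.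
by apply: eq_integral => x _; congr EFin; ring.
Qed.

Lemma superlevel_open r : tau [set f | E f /\ (r%:E < phi f)%E].
Proof.
have C_E : sublevel r `<=` E by move=> f [].
have Cs : saturated mu (sublevel r).
  move=> f g [Ef fr] mg fg; have Eg := spanL0_ae mu _ _ _ Ef mg fg.
  by split => //; rewrite -(phi_ae _ _ Ef Eg fg).
rewrite [X in tau X](_ : _ = E `\` sublevel r); last first.
  apply/seteqP; split => f [Ef].
    by rewrite ltNge => /negP fr; split => // -[].
  by move=> nf; split => //; rewrite ltNge; apply/negP => fr; apply: nf.
suff /(proj2 (KS _ C_E Cs (convex_sublevel r)))[] : forall l, 0 < l ->
  tau_closed E tau (sublevel r `&` scale_set l K) by [].
move=> l l0; split; first by move=> f [[]].
(* The points strictly separated from the sublevel set in [l K]; the set is weakly open because the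
   same [g] works nearby with [eta / 2]. *)
pose V := [set f | E f /\ exists g, F g /\ exists2 eta, 0 < eta &
  forall h, sublevel r h -> scale_set l K h -> eta <= pairing mu (fun x => h x - f x) g].
have KE := scaleK_E l.
have oV : sigma_open mu E F V.
  split => [f []//|f [Ef [g [Fg [eta eta0 H]]]]].
  exists 1%N, (fun=> g), (eta / 2); split => //; first by rewrite divr_gt0.
  move=> h Eh /(_ ord0) hf; split => //; exists g; split => //.
  exists (eta / 2); first by rewrite divr_gt0.
  move=> k kr kl; have := H _ kr kl; have Ek := KE _ kl; move: hf.
  rewrite !pairingEB//.
  have := ler_norm (pairing mu h g - pairing mu f g); lra.
have [U [tU UV]] := rel_open _ _ l0 oV.
(* Inside [l K] the open set [U] agrees with [V], which misses the sublevel set: separating a point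
   from itself would give [eta <= 0]. *)
rewrite (_ : _ `\` _ = (E `\` scale_set l K) `|` U).
  by apply: tauU => //; exact: tau_scaleK_closed.
apply/seteqP; split => f.
  move=> [Ef nf]; have [lf|nlf] := pselect (scale_set l K f); last by left.
  right; suff [] : (U `&` scale_set l K) f by [].
  rewrite UV; split => //; split => //.
  by apply: sublevel_weakly_separated => // fr; apply: nf.
move=> [[Ef nf]|Uf]; first by split => // -[].
split; first exact: (tau_sub) Uf.
move=> [fr fl]; have [[Ef [g [Fg [eta eta0 H]]]] _] : (V `&` scale_set l K) f.
  by rewrite -UV.
have := H _ fr fl; rewrite pairingEB// subrr; lra.
Qed.

(** * Continuous affine minorants of [phi] *)

Let EZ a f : E f -> E (fun x => a * f x).
Proof.
move=> Ef; have := E_lin a 0 _ _ Ef Ef; congr spanL0.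
by apply/funext => x; rewrite mul0r addr0.
Qed.

Let ED f g : E f -> E g -> E (fun x => f x + g x).
Proof.
move=> Ef Eg; have := E_lin 1 1 _ _ Ef Eg; congr spanL0.
by apply/funext => x; rewrite !mul1r.
Qed.

Let EB f g : E f -> E g -> E (fun x => f x - g x).
Proof.
move=> Ef Eg; have := E_lin 1 (-1) _ _ Ef Eg; congr spanL0.
by apply/funext => x; rewrite mul1r mulN1r.
Qed.

(** For a convex neighbourhood [V] of [f] inside [U], the intersection of [V - f] and [f - V] has
    all these properties. *)
Lemma symmetric_convex_nbhs U f : tau U -> U f -> exists W, [/\ tau W,
  W (fun=> 0), Defs.convex_set W, (forall w, W w -> W (fun x => - w x)) &
  forall w, W w -> E w /\ U (fun x => f x + w x)].
Proof.
move=> tU Uf; have [V [tV Vf VU Vc]] := tau_convex _ _ tU Uf.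
have Ef := tau_sub _ tU _ Uf.
exists ([set h | E h /\ V (fun x => 1 * h x + f x)] `&`
  [set h | E h /\ V (fun x => -1 * h x + f x)]); split.
- by apply: tauI; exact: tau_affine.
- have E0 := spanL0_0 mu K; split; split => //.
  + by move: Vf; congr V; apply/funext => x; rewrite mulr0 add0r.
  + by move: Vf; congr V; apply/funext => x; rewrite mulr0 add0r.
- move=> h k t [[Eh Vh] [_ Vh']] [[Ek Vk] [_ Vk']] t01.
  split; (split; first exact: E_lin).
  + have := Vc _ _ t Vh Vk t01; congr V; apply/funext => x; ring.
  + have := Vc _ _ t Vh' Vk' t01; congr V; apply/funext => x; ring.
- move=> h [[Eh Vh] [_ Vh']]; have ENh : E (fun x => - h x).
    by have := EZ (-1) _ Eh; congr spanL0; apply/funext => x; rewrite mulN1r.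
  split; split => //.
  + by move: Vh'; congr V; apply/funext => x; ring.
  + by move: Vh; congr V; apply/funext => x; ring.
- move=> h [[Eh Vh] _]; split => //; apply: VU.
  by move: Vh; congr V; apply/funext => x; ring.
Qed.

(** Continuity follows by scaling [W]. Compatibility with almost sure equality comes from
    boundedness too: all multiples of a null function lie in the saturated set [W], so [l] vanishes
    on it. *)
Lemma tau_dual_bounded (l : (T -> R) -> R) W n : tau W -> W (fun=> 0) ->
  (forall w, W w -> W (fun x => - w x)) ->
  (forall a b f g, E f -> E g -> l (fun x => a * f x + b * g x) = a * l f + b * l g) ->
  (forall w, W w -> l w <= n) -> tau_dual mu E tau l.
Proof.
move=> tW W0 WN ll lW; have lB f g : E f -> E g -> l (fun x => f x - g x) = l f - l g.
  move=> Ef Eg; have := ll 1 (-1) _ _ Ef Eg; rewrite mul1r mulN1r => <-.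
  by congr l; apply/funext => x; rewrite mul1r mulN1r.
have lZ a f : E f -> l (fun x => a * f x) = a * l f.
  move=> Ef; have := ll a 0 _ _ Ef Ef; rewrite mul0r addr0 => <-.
  by congr l; apply/funext => x; rewrite mul0r addr0.
have WE := tau_sub _ tW.
have n0 : 0 <= n.
  have l0 : l (fun=> 0) = 0.
    have := lB _ _ (spanL0_0 mu K) (spanL0_0 mu K); rewrite [RHS]subrr.
    by apply: etrans; congr l; apply/funext => x; rewrite subrr.
  by rewrite -l0; exact: lW.
have lWn w : W w -> `|l w| <= n.
  move=> Ww; rewrite ler_norml lW// andbT lerNl -mulN1r -lZ; last exact: WE.
  by under eq_fun do rewrite mulN1r; apply: lW; exact: WN.
split => [f g Ef Eg fg|f g a b Ef Eg|O oO]; last 2 first.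
- exact: ll.
- apply: tau_local => f [Ef Of].
  have [e /= e0 eO] := (proj1 (nbhs_ballP _ _)) (open_nbhs_nbhs (conj oO Of)).
  pose c := (n + 1) / e; have c0 : 0 < c by rewrite divr_gt0// ltr_wpDl.
  have Ecf := EZ (- c) _ Ef.
  exists [set h | E h /\ W (fun x => c * h x + - c * f x)].
    exact: tau_affine.
  split.
    split => //; move: W0; congr W; apply/funext => x; ring.
  move=> h [Eh Wh]; split => //; apply: eO; rewrite /ball /=.
  have := lWn _ Wh; rewrite ll// mulNr -mulrBr normrM (gtr0_norm c0).
  rewrite -ler_pdivlMl// distrC => H; apply: (le_lt_trans H).
  by rewrite ltr_pdivrMl// /c divfK ?gt_eqF// ltrDl.
- apply/eqP; rewrite -subr_eq0 -lB//; set z := fun x => f x - g x.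
  have Ez : E z by exact: EB.
  have H M : 0 < M -> M * `|l z| <= n.
    move=> M0; rewrite -{1}(gtr0_norm M0) -normrM -lZ//; apply: lWn.
    apply: (tau_saturated _ tW _ _ W0).
      by apply: spanL0_L0; exact: EZ.
    by apply: filterS fg => x fgx; rewrite /z fgx subrr mulr0.
  rewrite -normr_eq0 eq_le normr_ge0 andbT leNgt; apply/negP => lz0.
  have := H ((n + 1) / `|l z|) _; rewrite divfK ?gt_eqF//.
  by rewrite divr_gt0 ?ltr_wpDl// => /(_ isT); lra.
Qed.

(* Separation of [(f0, r)] from the epigraph of [phi] in the form of a cone of
   constraints [l y <= c]: the condition [l k <= p - r] whenever
   [phi (f0 + k) <= p], together with [l w <= n] for [w] in a neighbourhood of
   [0], chosen so that they are compatible even if [phi f0 = +oo]. *)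
Lemma affine_minorant (r : R) f0 : E f0 -> (r%:E < phi f0)%E ->
  exists g, F g /\ exists a : R,
    (forall h, E h -> ((pairing mu h g - a)%:E <= phi h)%E) /\
    r <= pairing mu f0 g - a.
Proof.
move=> Ef0 rf0; have [phiN [f1 [Ef1 f1y]] phic] := phi_cvx.
have f1fin : phi f1 \is a fin_num by rewrite fin_numE gt_eqF ?phiN//= lt_eqF.
pose p1 := fine (phi f1); have p1E : phi f1 = p1%:E by rewrite fineK.
have [W0 [tW0 W00 W0c W0N W0f]] := symmetric_convex_nbhs _ f0 (superlevel_open r) (conj Ef0 rf0).
(* Since [phi f0] may be infinite, the growth of [phi] far from [f0] is controlled from a point [f1]
   where [phi] is finite. *)
have [|W1 [tW1 W10 W1c W1N W1f]] := symmetric_convex_nbhs _ f1 (superlevel_open (p1 - 1)).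
  by split => //; rewrite p1E lte_fin ltrBlDr ltrDl.
pose W := W0 `&` W1; have tW : tau W by exact: tauI.
have WE := tau_sub _ tW.
have Wc : Defs.convex_set W.
  by move=> f g t [? ?] [? ?] t01; split; [exact: W0c|exact: W1c].
have WN w : W w -> W (fun x => - w x) by move=> [? ?]; split; [exact: W0N|exact: W1N].
have Wz : W (fun=> 0) by [].
have Wabs y : E y -> exists s w, [/\ 0 < s, W w & y = (fun x => s * w x)].
  move=> Ey; have [s s0 Ws] := tau_absorbing _ _ tW Ey Wz.
  exists s^-1, (fun x => s * y x); split => //; first by rewrite invr_gt0.
  by apply/funext => x; rewrite mulKf// gt_eqF.
have [s1 [w1 [s10 Ww1 fw1]]] := Wabs _ (EB _ _ Ef0 Ef1).
(* Chosen so that [r - n s <= p1 - s1 - s] for all [s >= 1]. *)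
pose n := 1 + `|r - p1 + s1|.
have n1 : 1 <= n by rewrite lerDl.
(* This is the compatibility of the constraints. For [s <= 1] the point stays where [phi > r]. For
   [s > 1], contracting it towards [f1] by the factor [1/q] lands where [phi > p1 - 1], and
   convexity gives [p > p1 - q]. *)
have low w s p : W w -> 0 <= s ->
    (phi (fun x => (f0 x + s * w x)%R) <= p%:E)%E -> r - n * s <= p.
  move=> Ww s0 php; have [sle|slt] := leP s 1.
    have Wsw : W (fun x => s * w x).
      have := Wc _ _ s Ww Wz; rewrite s0 sle => /(_ isT); congr W.
      by apply/funext => x; rewrite mulr0 addr0.
    have [_ [_]] := W0f _ (proj1 Wsw); move=> /lt_le_trans/(_ php).
    rewrite lte_fin => rp; have : 0 <= n * s by rewrite mulr_ge0//; lra.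
    lra.
  pose q := s1 + s; have q1 : 1 < q by rewrite /q; lra.
  have q0 : 0 < q by lra.
  have q01 : 0 <= q^-1 <= 1 by rewrite invr_ge0 (ltW q0) invf_le1// ltW.
  pose w2 x := s1 / q * w1 x + (1 - s1 / q) * w x.
  have sqE : 1 - s1 / q = s / q by rewrite /q; field; exact: lt0r_neq0.
  have Ww2 : W w2.
    apply: Wc => //; rewrite divr_ge0 ?(ltW s10) ?(ltW q0)//=.
    by rewrite ler_pdivrMr// mul1r /q lerDl.
  have Ef0s : E (fun x => f0 x + s * w x) by apply: ED => //; apply: EZ; exact: WE.
  have [_ [_]] := W1f _ (proj2 Ww2).
  have -> : (fun x => f1 x + w2 x) =
      (fun x => q^-1 * (f0 x + s * w x) + (1 - q^-1) * f1 x).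
    apply/funext => x; have := congr1 (@^~ x) fw1; rewrite /= => fx.
    have -> : f0 x = f1 x + s1 * w1 x by rewrite -fx; ring.
    by rewrite /w2 sqE; field; exact: lt0r_neq0.
  move=> /lt_le_trans/(_ (phic _ _ _ Ef0s Ef1 q01)).
  have : (q^-1%:E * phi (fun x => (f0 x + s * w x)%R) <= q^-1%:E * p%:E)%E.
    by apply: lee_wpmul2l => //; rewrite lee_fin; case/andP: q01.
  move=> /(leeD2r ((1 - q^-1)%:E * phi f1)%E) H /lt_le_trans/(_ H).
  rewrite p1E -!EFinM -EFinD lte_fin => H'.
  have H2 : q * (p1 - 1) < q * (q^-1 * p + (1 - q^-1) * p1) by rewrite ltr_pM2l.
  have E2 : q * (q^-1 * p + (1 - q^-1) * p1) = p + (q - 1) * p1.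
    by field; exact: lt0r_neq0.
  rewrite E2 in H2.
  have H3 : p1 - s1 - s < p.
    by move: H2; rewrite !(mulrBr, mulrBl) /q; lra.
  have H4 : `|r - p1 + s1| <= `|r - p1 + s1| * s by rewrite ler_peMr// ltW.
  have := ler_norm (r - p1 + s1); rewrite /n mulrDl mul1r; lra.
pose Q (k : T -> R) p := E k /\ (phi (fun x => (f0 x + k x)%R) <= p%:E)%E.
have Qc k1 q1 k2 q2 t : Q k1 q1 -> Q k2 q2 -> 0 <= t <= 1 ->
    Q (fun x => t * k1 x + (1 - t) * k2 x) (t * q1 + (1 - t) * q2).
  move=> [Ek1 h1] [Ek2 h2] t01; split; first exact: E_lin.
  have -> : (fun x => f0 x + (t * k1 x + (1 - t) * k2 x)) =
      (fun x => t * (f0 x + k1 x) + (1 - t) * (f0 x + k2 x)).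
    by apply/funext => x; ring.
  apply: (le_trans (phic _ _ t (ED _ _ Ef0 Ek1) (ED _ _ Ef0 Ek2) t01)).
  have -> : (t * q1 + (1 - t) * q2)%:E = (t%:E * q1%:E + (1 - t)%:E * q2%:E)%E.
    by rewrite -!EFinM -EFinD.
  have /andP[t0 t1] := t01.
  by apply: leeD; apply: lee_wpmul2l => //; rewrite lee_fin// subr_ge0.
pose S := [set yc : (T -> R) * R | exists t s k w p,
  [/\ 0 <= t, 0 <= s, Q k p, W w &
    yc = (fun x => t * k x + s * w x, t * (p - r) + n * s)]].
(* An element of [Q] is required even for constraints with weight [t = 0]; this one serves. *)
pose k1 x := f1 x - f0 x.
have Qk1 : Q k1 p1.
  split; first exact: EB.
  have -> : (fun x => f0 x + k1 x) = f1 by apply/funext => x; rewrite /k1; ring.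
  by rewrite p1E.
have oS : proper_cone E S.
  split.
  - move=> y c [t [s [k [w [p [_ _ [Ek _] Ww [-> _]]]]]]].
    by apply: E_lin => //; exact: WE.
  - move=> y1 c1 y2 c2 [t1 [s2 [k2 [w2 [p2 [t10 s20 Q2 Ww2 [-> ->]]]]]]]
      [t3 [s3 [k3 [w3 [p3 [t30 s30 Q3 Ww3 [-> ->]]]]]]].
    have [k [p [Qk kE pE]]] := convex_cone_sum Q _ _ _ _ _ _ Qc Q2 Q3 t10 t30.
    have Wc' w q w' q' t : W w -> W w' -> 0 <= t <= 1 ->
      (fun w _ => W w) (fun x => t * w x + (1 - t) * w' x) (t * q + (1 - t) * q').
      exact: Wc.
    have [w [_ [Ww wE _]]] := convex_cone_sum (fun w _ => W w) _ 0 _ 0 _ _ Wc' Ww2 Ww3 s20 s30.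
    exists (t1 + t3), (s2 + s3), k, w, p; split; [by rewrite addr_ge0..| | |] => //.
    congr pair.
      apply/funext => x; rewrite -kE -wE.
      transitivity ((t1 * k2 x + s2 * w2 x) + (t3 * k3 x + s3 * w3 x)) => //.
      by ring.
    by rewrite !mulrBr -pE; ring.
  - move=> a y c a0 [t [s [k [w [p [t0 s0 Qk Ww [-> ->]]]]]]].
    exists (a * t), (a * s), k, w, p; split; [by rewrite mulr_ge0..| | |] => //.
    congr pair; last by ring.
    by apply/funext => x; rewrite -!mulrA -mulrDr.
  - move=> y Ey; have [s [w [s0 Ww ->]]] := Wabs _ Ey.
    exists (0 * (p1 - r) + n * s), 0, s, k1, w, p1; split => //; first exact: ltW.
    by congr pair; apply/funext => x; rewrite mul0r add0r.
  (* A constraint at [0] with [t > 0] means [k = - (s/t) w], and [low] applies to [- w]. *)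
  - move=> c [t [s [k [w [p [t0 s0 [Ek kp] Ww [zE ->]]]]]]].
    have [t00|tn0] := eqVneq t 0.
      by rewrite t00 mul0r add0r mulr_ge0//; lra.
    have tp : 0 < t by rewrite lt_def tn0.
    have := low _ (s / t) p (WN _ Ww) (divr_ge0 s0 t0).
    have -> : (fun x => f0 x + s / t * - w x) = (fun x => f0 x + k x).
      apply/funext => x; congr (_ + _).
      have := congr1 (@^~ x) zE; rewrite /= => /esym/eqP.
      rewrite addrC addr_eq0 => /eqP H.
      by rewrite mulrN mulrAC H mulNr opprK mulrAC divff// mul1r.
    move=> /(_ kp); rewrite -subr_ge0 => H.
    have -> : t * (p - r) + n * s = t * (p - (r - n * (s / t))).
      by field.
    by rewrite mulr_ge0.
have [l [ll lS]] : exists l : (T -> R) -> R,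
    (forall a b y z, E y -> E z -> l (a *: y + b *: z) = a * l y + b * l z) /\
    (forall y c, S (y, c) -> l y <= c).
  apply: hahn_banach_cone oS; [|exact: ED|exact: EZ].
  by move=> y Ey; have := EZ (-1) _ Ey; congr spanL0; apply/funext => x; rewrite mulN1r.
have lW w : W w -> l w <= n.
  move=> Ww; apply: lS; exists 0, 1, k1, w, p1; split => //.
  congr pair; last by ring.
  by apply/funext => x; ring.
have lQ k p : Q k p -> l k <= p - r.
  move=> Qk; apply: lS; exists 1, 0, k, (fun=> 0), p; split => //.
  congr pair; last by ring.
  by apply/funext => x; ring.
have [_ /(_ l (tau_dual_bounded _ _ _ tW Wz WN ll lW))[g [Fg lg]]] := Freg.
(* The constant makes the minorant take the value [r] at [f0]. *)
exists g; split => //; exists (pairing mu f0 g - r); split; last by lra.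
move=> h Eh; rewrite -!lg//; case ph: (phi h) (phiN _ Eh) => [p||]// _.
  have : Q (fun x => h x - f0 x) p.
    split; first exact: EB.
    have -> : (fun x => f0 x + (h x - f0 x)) = h by apply/funext => x; ring.
    by rewrite ph.
  move/lQ; have := ll 1 (-1) _ _ Eh Ef0; rewrite scale1r scaleN1r mul1r mulN1r.
  by rewrite lee_fin => ->; lra.
by rewrite leey.
Qed.

(** * The extension as a supremum of affine minorants *)

Lemma fatou_extension : exists psi : (T -> R) -> \bar R,
  [/\ fun_on_L0 mu (spanL0 mu (solL0 mu K)) psi,
      convex_proper_on (spanL0 mu (solL0 mu K)) psi,
      equicontinuous_Fatou mu (solL0 mu K) psi &
      forall f, E f -> psi f = phi f].
Proof.
have [phiN [f1 [Ef1 f1y]] phic] := phi_cvx.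
pose A := [set ga : (T -> R) * R | F ga.1 /\ forall h, spanL0 mu K h ->
  ((pairing mu h ga.1 - ga.2)%:E <= phi h)%E].
pose psi f := ereal_sup [set (pairing mu f ga.1 - ga.2)%:E | ga in A].
have psi_ge ga f : A ga -> ((pairing mu f ga.1 - ga.2)%:E <= psi f)%E.
  by move=> Aga; apply: ereal_sup_ubound; exists ga.
(* One minorant keeps the supremum [psi] above [-oo] on the larger span. *)
have A0 : A !=set0.
  have [r rf1] : exists r : R, (r%:E < phi f1)%E.
    case E1: (phi f1) f1y (phiN _ Ef1) => [p||]// _ _.
    by exists (p - 1); rewrite lte_fin ltrBlDr ltrDl.
  by have [g [Fg [a [Ha _]]]] := affine_minorant r f1 Ef1 rf1; exists (g, a).
have psiE f : spanL0 mu K f -> psi f = phi f.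
  move=> Ef; apply/eqP; rewrite eq_le; apply/andP; split.
    by apply: ge_ereal_sup => _ [ga [_ H] <-]; exact: H.
  rewrite leNgt; apply/negP => psi_lt.
  have [r pr rf] : exists2 r : R, (psi f < r%:E)%E & (r%:E < phi f)%E.
    have [ga0 Aga0] := A0.
    have [q qE] : exists q : R, psi f = q%:E.
      have := psi_ge _ f Aga0; have := lt_le_trans psi_lt (leey _).
      by case: (psi f) => [q||]// _ _; exists q.
    move: psi_lt; rewrite qE; case: (phi f) => [p||]// qp.
      exists ((q + p) / 2); rewrite lte_fin; move: qp; rewrite lte_fin; lra.
    by exists (q + 1); [rewrite lte_fin ltrDl|rewrite ltry].
  have [g [Fg [a [Ha ra]]]] := affine_minorant r f Ef rf.
  have := psi_ge (g, a) f (conj Fg Ha); rewrite leNgt => /negP; apply.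
  by apply: (lt_le_trans pr); rewrite lee_fin.
exists psi; split => //.
- move=> f g Ef Eg fg; rewrite /psi; congr ereal_sup.
  apply/seteqP; split => _ [ga Aga <-]; exists ga => //; congr (_ - _)%:E.
  + apply: pairing_ae (aeeq_sym _ _ _ fg); [exact: spanL0_L0 Eg|exact: spanL0_L0 Ef|].
    exact: (F_L0 _ (proj1 Aga)).
  + apply: pairing_ae fg; [exact: spanL0_L0 Ef|exact: spanL0_L0 Eg|].
    exact: (F_L0 _ (proj1 Aga)).
- split.
  + move=> f Ef; have [ga Aga] := A0.
    exact: lt_le_trans (ltNyr _) (psi_ge _ f Aga).
  + by exists f1; split; [exact: E_sol|rewrite psiE].
  + move=> f g t Ef Eg /andP[t0 t1]; apply: ge_ereal_sup => _ [ga Aga <-].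
    rewrite pairingDl; [|exact: intg_solF (proj1 Aga)..].
    set a := pairing mu f _; set b := pairing mu g _.
    have -> : t * a + (1 - t) * b - ga.2 = t * (a - ga.2) + (1 - t) * (b - ga.2).
      by ring.
    rewrite EFinD !EFinM; apply: leeD; apply: lee_wpmul2l; rewrite ?lee_fin ?subr_ge0//.
    * exact: psi_ge.
    * exact: psi_ge.
(* Each minorant converges along the sequence, so its limit value is below the lower limit of [psi];
   then take the supremum. *)
- move=> u f l l0 ul Ef uf; apply: ge_ereal_sup => _ [ga Aga <-].
  apply: (@limn_einf_ge _ (fun n => pairing mu (u n) ga.1 - ga.2)); last first.
    by move=> n; exact: psi_ge.
  apply: cvgB; last exact: cvg_cst.
  exact: (pairing_cvg _ _ _ l (proj1 Aga)).
Qed.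

End Extension.

Theorem theorem5p7 (d : measure_display) (T : measurableType d)
  (R : realType) (mu : probability T R)
  (K : set (T -> R)) (phi : (T -> R) -> \bar R)
  (tau : set (set (T -> R))) (F : set (T -> R)) :
  measure_is_complete mu ->
  K `<=` L0 ->
  absolutely_convex K -> closed_in_prob mu K -> bounded_in_prob mu K ->
  fun_on_L0 mu (spanL0 mu K) phi ->
  convex_proper_on (spanL0 mu K) phi ->
  equicontinuous_Fatou mu K phi ->
  lc_topology mu (spanL0 mu K) tau ->
  equicontinuous_Kothe mu K F tau ->
  Krein_Smulian mu K tau ->
  F_regular mu K F tau ->
  exists psi : (T -> R) -> \bar R,
    [/\ fun_on_L0 mu (spanL0 mu (solL0 mu K)) psi,
        convex_proper_on (spanL0 mu (solL0 mu K)) psi,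
        equicontinuous_Fatou mu (solL0 mu K) psi &
        forall f, spanL0 mu K f -> psi f = phi f].
Proof.
move=> _ KL Ka Kc _ phi_ae phi_cvx phi_fatou lc [Kcpt ind] KS Freg.
(* An empty [K] coincides with its solid hull, and [phi] is its own extension. *)
have [K0|K0] := pselect (K !=set0); first exact: (fatou_extension mu K F tau).
have KE : solL0 mu K = K.
  apply/seteqP; split => f; last by move=> Kf; exfalso; apply: K0; exists f.
  by move=> [_ [g [Kg _]]]; exfalso; apply: K0; exists g.
by exists phi; rewrite KE; split.
Qed.
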